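(* Let $s\ge 6$ be even and $N\ge 2s$. Then for all $t\in[-\pi,\pi]\setminus\{0\}$ and $l=0,1,2,3$, $$|\tilde\sigma_N^{(l)}(t)|\le\frac{c_{l,s}}{(N+1)^{s-l}|t|^s},$$ where $c_{0,s}=1.02\,(s-1)!\,2^s s$, $c_{1,s}=1.02\,(s-1)!\,2^s\cdot 2s$, $c_{2,s}=1.02\,(s-1)!\,2^s(4s+1)$, $c_{3,s}=1.02\,(s-1)!\,2^s(9s-2)$.
   Context: For even $s\ge 6$, the perfect B-spline is $g_{s-1}(x)=\frac{(-1)^{s-1}}{(s-2)!}\int_{-1}^{x}\sum_{k=0}^{s-1}(-1)^k\chi_{(\cos(\frac{(k+1)\pi}{s}),\cos(\frac{k\pi}{s})]}(t)(x-t)^{s-2}\,dt$ for $x\in[-1,1]$ and $0$ otherwise; $\tilde g_{s-1}(x)=g_{s-1}(2x)$. For $N\in\mathbb N$, $\|\tilde g_{s-1}\|_{1,N}=\sum_{k=-N}^N\tilde g_{s-1}(\frac{k}{2(N+1)})$ and $\tilde\sigma_N(t)=\|\tilde g_{s-1}\|_{1,N}^{-1}\sum_{k=-N}^{N}\tilde g_{s-1}(\frac{k}{2(N+1)})e^{ikt}$, a trigonometric polynomial; $\tilde\sigma_N^{(l)}$ is its $l$-th derivative. *)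

(* Defs.v *)
From Stdlib Require Import Reals Factorial Lra Lia Classical ClassicalEpsilon.
Open Scope R_scope.

(* Riemann integral of f over [a,b] (oriented, as in Stdlib), defined as
   RiemannInt of some integrability proof when f is Riemann integrable
   (the value does not depend on the proof), and 0 otherwise. *)
Definition RInt (f : R -> R) (a b : R) : R :=
  match excluded_middle_informative (inhabited (Riemann_integrable f a b)) with
  | left h => RiemannInt (epsilon h (fun _ => True))
  | right _ => 0
  end.

Definition chi (a b t : R) : R :=
  if Rlt_dec a t then (if Rle_dec t b then 1 else 0) else 0.

Definition g (s : nat) (x : R) : R :=
  if Rle_dec (-1) x then
    if Rle_dec x 1 then
      (-1) ^ (s - 1) / INR (Factorial.fact (s - 2)) *
      RInt (fun t => sum_f_R0 (fun k => (-1) ^ k *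
                 chi (cos (INR (k + 1) * PI / INR s)) (cos (INR k * PI / INR s)) t) (s - 1)
                 * (x - t) ^ (s - 2)) (-1) x
    else 0
  else 0.

Definition gt (s : nat) (x : R) : R := g s (2 * x).

(* coefficient \tilde g_{s-1}(k / (2(N+1))) for k = j - N, j = 0..2N *)
Definition coef (s N j : nat) : R :=
  gt s ((INR j - INR N) / (2 * (INR N + 1))).

Definition gnorm (s N : nat) : R := sum_f_R0 (fun j => coef s N j) (2 * N).

Definition sigma_re (s N : nat) (t : R) : R :=
  / gnorm s N * sum_f_R0 (fun j => coef s N j * cos ((INR j - INR N) * t)) (2 * N).
Definition sigma_im (s N : nat) (t : R) : R :=
  / gnorm s N * sum_f_R0 (fun j => coef s N j * sin ((INR j - INR N) * t)) (2 * N).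

Inductive nth_deriv : nat -> (R -> R) -> (R -> R) -> Prop :=
  | nth_deriv_0 : forall f, nth_deriv 0 f f
  | nth_deriv_S : forall n f h h',
      nth_deriv n f h -> (forall t, derivable_pt_lim h t (h' t)) ->
      nth_deriv (S n) f h'.

Definition cst (l s : nat) : R :=
  102 / 100 * INR (Factorial.fact (s - 1)) * 2 ^ s *
  match l with
  | 0 => INR s
  | 1 => 2 * INR s
  | 2 => 4 * INR s + 1
  | _ => 9 * INR s - 2
  end.

(* Main.v *)
(** The perfect B-spline is [g x = altdiff (fun y => (x - y)_+^(s-1) / (s-1)!)], where
    [altdiff p] is the alternating sum of the increments of [p] between the Chebyshev
    extremal points.  By discrete orthogonality of cosines [altdiff] kills the polynomials
    of degree less than [s], so [g] is supported in [[-1, 1]]; [altdiff (y^s)] gives its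
    integral; and a Rolle argument counting the zeros of the derivatives shows [g >= 0].

    Fourier transforms are replaced by the following discrete argument.  The averaging
    identity for [n]-th roots of unity writes the trigonometric sum of [x^l g x] on the grid
    of step [h] at frequency [t] as the mean of the sums on the grid of step [h / n] at
    frequencies [(t + 2 pi j) / n].  On the fine grid, backward differences multiply the sum
    by a power of [2 sin] of half the frequency and turn each truncated power into a cardinal
    B-spline, which is nonnegative of total mass one.  This bounds the sum by
    [2 s] times a sum over [j] of powers of [1 / |n 2 sin ((t + 2 pi j) / 2n)|], in which for
    large [n] only [j = 0] and the [j] nearest to it on the other side matter.
    The same identity at [t = 0] shows that the normalisation is close to [(N + 1)]
    times the integral of [g].  For small [(N + 1) |t|] the bound [(N + 1)^l] on the [l]-th
    derivative suffices, because [s! >= (4 s / 11)^s]. *)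

From Stdlib Require Import Reals ZArith Lra Lia ClassicalEpsilon.
From Coquelicot Require Coquelicot.
Require Import Defs.
Open Scope R_scope.

(** * Alternating differences at the Chebyshev points *)

Definition knot (s k : nat) : R := cos (INR k * PI / INR s).

(** For [s >= 1] this is [4 s / 2^s] times the divided difference of order [s] at the knots.
    Consecutive terms combine into a trapezoidal sum of [(-1)^k p (knot s k)], with weight 1 at both
    ends and 2 inside. *)
Definition altdiff (s : nat) (p : R -> R) : R :=
  sum_f_R0 (fun k => (-1) ^ k * (p (knot s k) - p (knot s (k + 1)))) (s - 1).

Lemma altdiff_ext (s : nat) (p q : R -> R) :
  (forall y, -1 <= y <= 1 -> p y = q y) -> altdiff s p = altdiff s q.
Proof.
  intros H. apply sum_eq. intros i _.
  unfold knot. rewrite !H by apply COS_bound. reflexivity.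
Qed.

Lemma altdiff_plus (s : nat) (p q : R -> R) :
  altdiff s (fun y => p y + q y) = altdiff s p + altdiff s q.
Proof.
  unfold altdiff. rewrite <- sum_plus. apply sum_eq. intros; ring.
Qed.

Lemma altdiff_scal (s : nat) (c : R) (p : R -> R) :
  altdiff s (fun y => c * p y) = c * altdiff s p.
Proof.
  unfold altdiff. rewrite scal_sum. apply sum_eq. intros; ring.
Qed.

Lemma sum_const_le (f : nat -> R) (B : R) (n : nat) :
  (forall k, (k <= n)%nat -> f k <= B) -> sum_f_R0 f n <= INR (S n) * B.
Proof.
  intros H. rewrite Rmult_comm, <- sum_cte. apply sum_Rle. exact H.
Qed.

Lemma altdiff_bound (s : nat) (p : R -> R) (B : R) :
  (1 <= s)%nat -> (forall y, -1 <= y <= 1 -> Rabs (p y) <= B) ->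
  Rabs (altdiff s p) <= 2 * INR s * B.
Proof.
  intros Hs H. unfold altdiff.
  eapply Rle_trans; [apply Rsum_abs|].
  replace (2 * INR s * B) with (INR (S (s - 1)) * (2 * B))
    by (replace (S (s - 1)) with s by lia; ring).
  apply sum_const_le. intros k _. rewrite Rabs_mult, pow_1_abs, Rmult_1_l.
  pose proof (H (knot s k) (COS_bound _)) as H1.
  pose proof (H (knot s (k + 1)) (COS_bound _)) as H2.
  unfold Rminus. eapply Rle_trans; [apply Rabs_triang|]. rewrite Rabs_Ropp. lra.
Qed.

Lemma cos_mult_half (a b : R) : cos a * cos b = / 2 * (cos (b + a) + cos (b - a)).
Proof. rewrite cos_plus, cos_minus. lra. Qed.

Lemma sin_INR_PI (k : nat) : sin (INR k * PI) = 0.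
Proof. apply sin_eq_0_1. exists (Z.of_nat k). now rewrite <- INR_IZR_INZ. Qed.

Lemma cos_INR_PI (k : nat) : cos (INR k * PI) = (-1) ^ k.
Proof.
  induction k as [|k IH].
  - simpl. rewrite Rmult_0_l. apply cos_0.
  - rewrite S_INR, Rmult_plus_distr_r, Rmult_1_l, neg_cos, IH. simpl. ring.
Qed.

(* Trapezoidal sums of a cosine telescope after multiplication by [sin (a / 2)]. *)
Lemma trapezoid_cos (a : R) (n : nat) :
  sin (a / 2) * sum_f_R0 (fun k => cos (INR k * a) + cos ((INR k + 1) * a)) n
  = cos (a / 2) * sin (INR (S n) * a).
Proof.
  assert (E : forall x, sin (a / 2) * (cos x + cos (x + a))
                        = cos (a / 2) * (sin (x + a) - sin x)).
  { intros x. set (y := x + a / 2).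
    replace x with (y - a / 2) by (unfold y; field).
    replace (y - a / 2 + a) with (y + a / 2) by field.
    rewrite cos_plus, cos_minus, sin_plus, sin_minus. ring. }
  induction n as [|n IH].
  - change (INR 1) with 1. cbn [sum_f_R0]. change (INR 0) with 0.
    rewrite Rmult_0_l, Rplus_0_l, Rmult_1_l.
    pose proof (E 0) as E0. rewrite Rplus_0_l, sin_0 in E0. rewrite E0. ring.
  - rewrite tech5, Rmult_plus_distr_l, IH, (S_INR (S n)).
    replace ((INR (S n) + 1) * a) with (INR (S n) * a + a) by ring.
    rewrite E. ring.
Qed.

(** Adding [PI] to the angle absorbs the sign [(-1)^k], and the change of sign between neighbours
    turns the difference into a sum. *)
Lemma altdiff_cos_sum (s m : nat) (p : R -> R) : (1 <= s)%nat ->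
  (forall k, (k <= s)%nat -> p (knot s k) = cos (INR m * (INR k * PI / INR s))) ->
  altdiff s p =
  sum_f_R0 (fun k => cos (INR k * (PI + INR m * PI / INR s))
                     + cos ((INR k + 1) * (PI + INR m * PI / INR s))) (s - 1).
Proof.
  intros Hs Hp. apply sum_eq. intros k Hk. rewrite !Hp by lia.
  assert (Hs0 : INR s <> 0) by (apply not_0_INR; lia).
  assert (E : forall j, cos (INR j * (PI + INR m * PI / INR s))
                        = (-1) ^ j * cos (INR m * (INR j * PI / INR s))).
  { intros j.
    replace (INR j * (PI + INR m * PI / INR s))
      with (INR j * PI + INR m * (INR j * PI / INR s)) by (field; auto).
    rewrite cos_plus, sin_INR_PI, cos_INR_PI. ring. }
  rewrite <- S_INR, !E. replace (k + 1)%nat with (S k) by lia. simpl. ring.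
Qed.

Lemma knot_angle (s k : nat) : (k <= s)%nat -> (1 <= s)%nat ->
  0 <= INR k * PI / INR s <= PI.
Proof.
  intros H1 H2. pose proof PI_RGT_0.
  assert (0 < INR s) by (apply lt_0_INR; lia).
  assert (INR k <= INR s) by (apply le_INR; lia). pose proof (pos_INR k).
  split.
  - apply Rmult_le_pos; [nra|]. left. now apply Rinv_0_lt_compat.
  - apply (Rmult_le_reg_r (INR s)); [lra|].
    replace (INR k * PI / INR s * INR s) with (INR k * PI) by (field; lra). nra.
Qed.

(** Discrete orthogonality: with [a = PI + m PI / s] the telescoped sum ends in
    [sin ((s + m) PI) = 0], and [sin (a / 2)] can be cancelled for [m < s]. For [m = s] the angle is
    [2 PI] and each of the [s] terms is 2. *)
Lemma altdiff_chebyshev (s m : nat) (p : R -> R) : (1 <= s)%nat -> (m <= s)%nat ->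
  (forall k, (k <= s)%nat -> p (knot s k) = cos (INR m * (INR k * PI / INR s))) ->
  altdiff s p = if (m =? s)%nat then 2 * INR s else 0.
Proof.
  intros Hs Hm Hp. rewrite (altdiff_cos_sum s m p Hs Hp).
  assert (Hs0 : 0 < INR s) by (apply lt_0_INR; lia).
  destruct (Nat.eqb_spec m s) as [->|Hne].
  - rewrite (sum_eq _ (fun _ => 2)).
    + rewrite sum_cte. replace (S (s - 1)) with s by lia. ring.
    + intros k _.
      assert (E : forall j, cos (INR j * (PI + INR s * PI / INR s)) = 1).
      { intros j. replace (INR j * (PI + INR s * PI / INR s)) with (0 + 2 * INR j * PI)
          by (field; lra). rewrite cos_period. apply cos_0. }
      rewrite <- S_INR, !E. ring.
  - set (a := PI + INR m * PI / INR s).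
    pose proof PI_RGT_0 as Hpi.
    assert (Ha : sin (a / 2) <> 0).
    { assert (0 <= INR m * PI / INR s < PI).
      { split; [apply knot_angle; lia|].
        assert (INR m < INR s) by (apply lt_INR; lia).
        apply (Rmult_lt_reg_r (INR s)); [lra|].
        replace (INR m * PI / INR s * INR s) with (INR m * PI) by (field; lra). nra. }
      apply Rgt_not_eq, sin_gt_0; unfold a; lra. }
    apply (Rmult_eq_reg_l (sin (a / 2))); [|exact Ha].
    rewrite trapezoid_cos. replace (S (s - 1)) with s by lia.
    replace (INR s * a) with (INR (s + m) * PI)
      by (unfold a; rewrite plus_INR; field; lra).
    rewrite sin_INR_PI. ring.
Qed.


(** The Chebyshev polynomial [T_m] on [[-1, 1]]. That it is a polynomial enters only through its
    values for [m = 0, 1] and the recurrence [cheb_rec]. *)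
Definition cheb (m : nat) (y : R) : R := cos (INR m * acos y).

Lemma cheb_0 (y : R) : cheb 0 y = 1.
Proof. unfold cheb. simpl. rewrite Rmult_0_l. apply cos_0. Qed.

Lemma cheb_1 (y : R) : -1 <= y <= 1 -> cheb 1 y = y.
Proof. intros H. unfold cheb. simpl. rewrite Rmult_1_l. now apply cos_acos. Qed.

Lemma cheb_rec (m : nat) (y : R) : -1 <= y <= 1 ->
  y * cheb (S m) y = / 2 * (cheb (S (S m)) y + cheb m y).
Proof.
  intros H. unfold cheb. rewrite <- (cos_acos y H) at 1.
  rewrite cos_mult_half, !S_INR. do 3 f_equal; ring.
Qed.

Lemma altdiff_cheb (s m : nat) : (1 <= s)%nat -> (m <= s)%nat ->
  altdiff s (cheb m) = if (m =? s)%nat then 2 * INR s else 0.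
Proof.
  intros Hs Hm. apply altdiff_chebyshev; auto.
  intros k Hk. unfold cheb, knot. rewrite acos_cos; [reflexivity|].
  apply knot_angle; lia.
Qed.

Lemma altdiff_pow_cheb_step (s a m : nat) :
  altdiff s (fun y => y ^ S a * cheb (S m) y)
  = / 2 * (altdiff s (fun y => y ^ a * cheb (S (S m)) y)
           + altdiff s (fun y => y ^ a * cheb m y)).
Proof.
  rewrite <- altdiff_plus, <- altdiff_scal. apply altdiff_ext. intros y Hy.
  simpl. rewrite (Rmult_comm y), Rmult_assoc, cheb_rec by exact Hy. ring.
Qed.

Lemma altdiff_pow_cheb_0 (s a : nat) :
  altdiff s (fun y => y ^ S a * cheb 0 y) = altdiff s (fun y => y ^ a * cheb 1 y).
Proof.
  apply altdiff_ext. intros y Hy. rewrite cheb_0, cheb_1 by exact Hy. simpl. ring.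
Qed.

(** Each factor [y] is traded for a step of the Chebyshev index up or down by one, so only [T_j]
    with [j < s] ever appear. *)
Lemma altdiff_pow_cheb_low (s a m : nat) : (1 <= s)%nat -> (a + m < s)%nat ->
  altdiff s (fun y => y ^ a * cheb m y) = 0.
Proof.
  intros Hs. revert m. induction a as [|a IH]; intros m Hm.
  - rewrite (altdiff_ext s _ (cheb m)) by (intros; simpl; ring).
    rewrite altdiff_cheb by lia. destruct (Nat.eqb_spec m s); [lia|reflexivity].
  - destruct m as [|m].
    + rewrite altdiff_pow_cheb_0. apply IH. lia.
    + rewrite altdiff_pow_cheb_step, !IH by lia. ring.
Qed.

(** Only the branch that always raises the index reaches [T_s], and each step costs a factor 1/2.
    The index starts at 1 or more because [y T_0 = T_1] carries no such factor. *)
Lemma altdiff_pow_cheb_top (s a m : nat) : (1 <= s)%nat -> (a + S m = s)%nat ->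
  altdiff s (fun y => y ^ a * cheb (S m) y) = 2 * INR s / 2 ^ a.
Proof.
  intros Hs. revert m. induction a as [|a IH]; intros m Hm.
  - rewrite (altdiff_ext s _ (cheb (S m))) by (intros; simpl; ring).
    rewrite altdiff_cheb by lia.
    destruct (Nat.eqb_spec (S m) s); [|lia]. simpl. field.
  - rewrite altdiff_pow_cheb_step, IH, altdiff_pow_cheb_low by lia.
    simpl. field. apply pow_nonzero. lra.
Qed.

Lemma altdiff_pow_low (s m : nat) : (m < s)%nat -> altdiff s (fun y => y ^ m) = 0.
Proof.
  intros H. rewrite (altdiff_ext s _ (fun y => y ^ m * cheb 0 y))
    by (intros; rewrite cheb_0; ring).
  apply altdiff_pow_cheb_low; lia.
Qed.

Lemma altdiff_pow_top (s : nat) : (1 <= s)%nat ->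
  altdiff s (fun y => y ^ s) = 4 * INR s / 2 ^ s.
Proof.
  intros H. rewrite (altdiff_ext s _ (fun y => y ^ s * cheb 0 y))
    by (intros; rewrite cheb_0; ring).
  destruct s as [|s]; [lia|].
  rewrite altdiff_pow_cheb_0, altdiff_pow_cheb_top by lia.
  simpl. field. apply pow_nonzero. lra.
Qed.

(** Splitting off one factor [x - y] leaves a term of lower degree, which vanishes by induction, and
    one with an extra [- y]; so only the sign of the leading coefficient survives. *)
Lemma altdiff_shift_pow (s : nat) (x : R) (a : nat) : (1 <= s)%nat ->
  forall b, (a + b <= s)%nat ->
  altdiff s (fun y => (x - y) ^ a * y ^ b)
  = if (a + b =? s)%nat then (-1) ^ a * (4 * INR s / 2 ^ s) else 0.
Proof.
  intros Hs. induction a as [|a IH]; intros b Hb.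
  - rewrite (altdiff_ext s _ (fun y => y ^ b)) by (intros; simpl; ring).
    simpl plus. destruct (Nat.eqb_spec b s) as [->|Hne].
    + rewrite altdiff_pow_top by exact Hs. simpl. ring.
    + apply altdiff_pow_low. lia.
  - rewrite (altdiff_ext s _ (fun y => x * ((x - y) ^ a * y ^ b)
                                       + -1 * ((x - y) ^ a * y ^ S b)))
      by (intros; simpl; ring).
    rewrite altdiff_plus, !altdiff_scal, !IH by lia.
    destruct (Nat.eqb_spec (a + b) s); [lia|].
    replace (S a + b)%nat with (a + S b)%nat by lia.
    destruct (a + S b =? s)%nat; simpl; ring.
Qed.

Lemma altdiff_shift_pow_low (s m : nat) (x : R) : (m < s)%nat ->
  altdiff s (fun y => (x - y) ^ m) = 0.
Proof.
  intros H. rewrite (altdiff_ext s _ (fun y => (x - y) ^ m * y ^ 0))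
    by (intros; simpl; ring).
  rewrite altdiff_shift_pow by lia.
  destruct (Nat.eqb_spec (m + 0) s); [lia|reflexivity].
Qed.

Lemma altdiff_shift_pow_top (s : nat) (x : R) : (1 <= s)%nat -> Nat.Even s ->
  altdiff s (fun y => (x - y) ^ s) = 4 * INR s / 2 ^ s.
Proof.
  intros H [k Hk]. rewrite (altdiff_ext s _ (fun y => (x - y) ^ s * y ^ 0))
    by (intros; simpl; ring).
  rewrite altdiff_shift_pow by lia.
  destruct (Nat.eqb_spec (s + 0) s); [|lia].
  rewrite Hk at 1. rewrite pow_1_even. ring.
Qed.

(** * Truncated powers and positivity of the spline *)

(* The truncated power [x_+^r / r!]; at [r = 0] it is the indicator of [x > 0]. *)
Definition tpow (r : nat) (x : R) : R :=
  if Rlt_dec 0 x then x ^ r / INR (fact r) else 0.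

Lemma tpow_neg (r : nat) (x : R) : x <= 0 -> tpow r x = 0.
Proof. intros H. unfold tpow. destruct (Rlt_dec 0 x); lra. Qed.

Lemma tpow_pos (r : nat) (x : R) : 0 < x -> tpow r x = x ^ r / INR (fact r).
Proof. intros H. unfold tpow. destruct (Rlt_dec 0 x); lra. Qed.

Lemma tpow_nonneg_arg (r : nat) (x : R) : (1 <= r)%nat -> 0 <= x ->
  tpow r x = x ^ r / INR (fact r).
Proof.
  intros Hr [H| <-]; [now apply tpow_pos|].
  rewrite tpow_neg by lra. rewrite pow_i by lia. unfold Rdiv. ring.
Qed.

Lemma tpow_ge0 (r : nat) (x : R) : 0 <= tpow r x.
Proof.
  unfold tpow. destruct (Rlt_dec 0 x); [|lra].
  apply Rmult_le_pos; [apply pow_le; lra|].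
  left. apply Rinv_0_lt_compat, INR_fact_lt_0.
Qed.

Lemma tpow_mul (r : nat) (x : R) : x * tpow r x = INR (S r) * tpow (S r) x.
Proof.
  unfold tpow. destruct (Rlt_dec 0 x); [|ring].
  rewrite fact_simpl, mult_INR. simpl pow. field.
  split; [apply INR_fact_neq_0|now apply not_0_INR].
Qed.

Lemma tpow_scale (r : nat) (c x : R) : 0 < c -> tpow r (c * x) = c ^ r * tpow r x.
Proof.
  intros Hc. destruct (Rlt_dec 0 x) as [H|H].
  - rewrite !tpow_pos by nra. rewrite Rpow_mult_distr. unfold Rdiv. ring.
  - rewrite !tpow_neg by nra. ring.
Qed.

(** The exponent is at least 2 since [x_+] has no derivative at 0. At 0 the difference quotients
    from the right are those of the plain power, and those from the left vanish. *)
Lemma tpow_deriv (r : nat) (x : R) :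
  derivable_pt_lim (tpow (S (S r))) x (tpow (S r) x).
Proof.
  assert (Hp : forall y, derivable_pt_lim (fun z => z ^ S (S r) / INR (fact (S (S r)))) y
                          (y ^ S r / INR (fact (S r)))).
  { intros y.
    replace (y ^ S r / INR (fact (S r)))
      with (INR (S (S r)) * y ^ pred (S (S r)) * / INR (fact (S (S r)))
            + y ^ S (S r) * 0).
    - apply (derivable_pt_lim_mult (fun z => z ^ S (S r)) (fct_cte (/ INR (fact (S (S r)))))).
      + apply derivable_pt_lim_pow.
      + apply derivable_pt_lim_const.
    - rewrite (fact_simpl (S r)), mult_INR. simpl pred. field.
      split; [apply INR_fact_neq_0|now apply not_0_INR]. }
  assert (Loc : forall f h y d, 0 < d -> (forall z, Rabs (z - y) < d -> f z = h z) ->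
            forall l, derivable_pt_lim h y l -> derivable_pt_lim f y l).
  { intros f h y d Hd He l Hl eps Heps. destruct (Hl eps Heps) as [d' Hd'].
    assert (H0 : 0 < Rmin d d') by (apply Rmin_pos; [lra|apply cond_pos]).
    exists (mkposreal _ H0). intros k Hk Hkd. simpl in Hkd.
    rewrite !He.
    - apply Hd'; auto. eapply Rlt_le_trans; [exact Hkd|apply Rmin_r].
    - unfold Rminus; rewrite Rplus_opp_r, Rabs_R0. exact Hd.
    - replace (y + k - y) with k by ring.
      eapply Rlt_le_trans; [exact Hkd|apply Rmin_l]. }
  destruct (Rtotal_order x 0) as [H|[H|H]].
  - rewrite tpow_neg by lra.
    apply (Loc _ (fct_cte 0) x (- x)); [lra| |apply derivable_pt_lim_const].
    intros z Hz. apply tpow_neg. apply Rabs_def2 in Hz. lra.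
  - subst x. rewrite tpow_neg by lra.
    intros eps Heps. pose proof (Hp 0 eps Heps) as [d Hd]. exists d.
    intros k Hk Hkd. specialize (Hd k Hk Hkd).
    rewrite (tpow_neg _ 0), Rplus_0_l by lra.
    rewrite !Rplus_0_l, (pow_i (S r)), (pow_i (S (S r))) in Hd by lia.
    destruct (Rlt_dec 0 k).
    + rewrite tpow_pos by lra.
      match goal with |- Rabs ?a < _ => match type of Hd with Rabs ?b < _ =>
        replace a with b by (field; repeat split; try exact Hk; apply INR_fact_neq_0) end end.
      exact Hd.
    + rewrite tpow_neg by lra. rewrite Rminus_0_r, Rminus_0_r, Rdiv_0_l, Rabs_R0. exact Heps.
  - rewrite tpow_pos by lra.
    eapply (Loc _ _ x x); [lra| |apply Hp].
    intros z Hz. apply tpow_pos. apply Rabs_def2 in Hz. lra.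
Qed.

Lemma tpow_incr (r : nat) (x y : R) : x <= y -> tpow r x <= tpow r y.
Proof.
  intros H. destruct (Rlt_dec 0 x) as [Hx|Hx].
  - rewrite !tpow_pos by lra. apply Rmult_le_compat_r.
    + left. apply Rinv_0_lt_compat, INR_fact_lt_0.
    + apply pow_incr. lra.
  - rewrite (tpow_neg r x) by lra. apply tpow_ge0.
Qed.

Lemma tpow_mvt (r : nat) (x d : R) : (1 <= r)%nat -> 0 < d ->
  d * tpow r x <= tpow (S r) (x + d) - tpow (S r) x <= d * tpow r (x + d).
Proof.
  intros Hr Hd. destruct r as [|r]; [lia|].
  destruct (MVT_cor2 (tpow (S (S r))) (tpow (S r)) x (x + d)) as [c [Hc1 Hc2]];
    [lra|intros; apply tpow_deriv|].
  rewrite Hc1. replace (x + d - x) with d by ring. rewrite (Rmult_comm (tpow (S r) c)).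
  split; apply Rmult_le_compat_l; try lra; apply tpow_incr; lra.
Qed.

(** The value [r = s - 1] gives the perfect B-spline, see [g_spl], and smaller [r >= 1] its
    successive derivatives, which the zero count descends through. *)
Definition spl (s r : nat) (x : R) : R := altdiff s (fun y => tpow r (x - y)).

Lemma spl_left (s r : nat) (x : R) : x <= -1 -> spl s r x = 0.
Proof.
  intros H. unfold spl. rewrite (altdiff_ext s _ (fun y => 0 * 0)).
  - rewrite altdiff_scal. ring.
  - intros y Hy. rewrite tpow_neg by lra. ring.
Qed.

(** To the right of all knots the truncation is inactive, which leaves a polynomial of degree
    [r < s]. *)
Lemma spl_right (s r : nat) (x : R) : (1 <= r)%nat -> (r < s)%nat -> 1 <= x ->
  spl s r x = 0.
Proof.
  intros H1 H2 Hx. unfold spl.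
  rewrite (altdiff_ext s _ (fun y => / INR (fact r) * (x - y) ^ r)).
  - rewrite altdiff_scal, altdiff_shift_pow_low by exact H2. ring.
  - intros y Hy. rewrite tpow_nonneg_arg by (lia || lra). unfold Rdiv. ring.
Qed.

Lemma derivable_pt_lim_sum (f f' : nat -> R -> R) (x : R) (n : nat) :
  (forall k, (k <= n)%nat -> derivable_pt_lim (f k) x (f' k x)) ->
  derivable_pt_lim (fun y => sum_f_R0 (fun k => f k y) n) x (sum_f_R0 (fun k => f' k x) n).
Proof.
  induction n as [|n IH]; intros H.
  - apply (H 0%nat). lia.
  - simpl. apply (derivable_pt_lim_plus (fun y => sum_f_R0 (fun k => f k y) n) (f (S n))).
    + apply IH. intros; apply H; lia.
    + apply H. lia.
Qed.

Lemma spl_deriv (s r : nat) (x : R) :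
  derivable_pt_lim (spl s (S (S r))) x (spl s (S r) x).
Proof.
  assert (E : forall y, derivable_pt_lim (fun z => tpow (S (S r)) (z - y)) x (tpow (S r) (x - y))).
  { intros y. replace (tpow (S r) (x - y)) with (tpow (S r) (x - y) * (1 - 0)) by ring.
    apply (derivable_pt_lim_comp (fun z => z - y) (tpow (S (S r)))).
    - apply (derivable_pt_lim_minus id (fct_cte y)).
      + apply derivable_pt_lim_id.
      + apply derivable_pt_lim_const.
    - apply tpow_deriv. }
  apply (derivable_pt_lim_sum
    (fun k z => (-1) ^ k * (tpow (S (S r)) (z - knot s k) - tpow (S (S r)) (z - knot s (k + 1))))
    (fun k z => (-1) ^ k * (tpow (S r) (z - knot s k) - tpow (S r) (z - knot s (k + 1))))).
  intros k _. cbv beta.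
  apply (derivable_pt_lim_scal (fun z => tpow (S (S r)) (z - knot s k) - tpow (S (S r)) (z - knot s (k + 1)))).
  apply (derivable_pt_lim_minus (fun z => tpow (S (S r)) (z - knot s k))
           (fun z => tpow (S (S r)) (z - knot s (k + 1)))); apply E.
Qed.

(** * Counting zeros with Rolle's theorem *)

Definition zero_chain (f : R -> R) (n : nat) : Prop :=
  exists z : nat -> R, z 0%nat = -1 /\ z n = 1 /\
    (forall i, (i < n)%nat -> z i < z (S i)) /\ (forall i, (i <= n)%nat -> f (z i) = 0).

(** Rolle's theorem puts a zero of [f'] inside each of the [n] intervals, and the endpoints are
    zeros of [f'] by hypothesis: one interval more than before. *)
Lemma zero_chain_deriv (f f' : R -> R) (n : nat) : (1 <= n)%nat ->
  (forall x, derivable_pt_lim f x (f' x)) -> f' (-1) = 0 -> f' 1 = 0 ->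
  zero_chain f n -> zero_chain f' (S n).
Proof.
  intros Hn Hf Hl Hr (z & Hz0 & Hzn & Hinc & Hz).
  assert (Ex : forall i, exists c, (i < n)%nat -> z i < c < z (S i) /\ f' c = 0).
  { intros i. destruct (le_lt_dec n i) as [Hi|Hi]; [exists 0; lia|].
    destruct (MVT_cor2 f f' (z i) (z (S i))) as [c [Hc1 Hc2]]; [now apply Hinc|auto|].
    exists c. intros _. split; [exact Hc2|].
    rewrite !Hz in Hc1 by lia. specialize (Hinc i Hi).
    assert (f' c * (z (S i) - z i) = 0) by lra.
    apply Rmult_integral in H. lra. }
  pose (w := fun i => proj1_sig (constructive_indefinite_description _ (Ex i))).
  assert (Hw : forall i, (i < n)%nat -> z i < w i < z (S i) /\ f' (w i) = 0)
    by (intros i; exact (proj2_sig (constructive_indefinite_description _ (Ex i)))).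
  exists (fun i => match i with O => -1 | S j => if (j <? n)%nat then w j else 1 end).
  split; [reflexivity|split; [now rewrite Nat.ltb_irrefl|split]].
  - intros [|i] Hi.
    + destruct (Nat.ltb_spec 0 n); [|lia]. destruct (Hw 0%nat H). lra.
    + destruct (Nat.ltb_spec i n); [|lia]. destruct (Hw i H) as [? _].
      destruct (Nat.ltb_spec (S i) n) as [H1|H1].
      * destruct (Hw (S i) H1). lra.
      * replace (S i) with n in H0 by lia. lra.
  - intros [|i] Hi; [exact Hl|].
    destruct (Nat.ltb_spec i n); [|exact Hr]. apply Hw. exact H.
Qed.

Lemma knot_0 (s : nat) : knot s 0 = 1.
Proof. unfold knot. simpl. unfold Rdiv. rewrite !Rmult_0_l. apply cos_0. Qed.

Lemma knot_last (s : nat) : (1 <= s)%nat -> knot s s = -1.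
Proof.
  intros H. unfold knot. replace (INR s * PI / INR s) with PI; [apply cos_PI|].
  field. apply not_0_INR. lia.
Qed.

Lemma knot_lt (s i j : nat) : (i < j)%nat -> (j <= s)%nat -> knot s j < knot s i.
Proof.
  intros Hij Hj. assert (0 < INR s) by (apply lt_0_INR; lia).
  assert (INR i < INR j) by (apply lt_INR; lia). pose proof PI_RGT_0.
  apply cos_decreasing_1; try (apply knot_angle; lia).
  unfold Rdiv. apply Rmult_lt_compat_r; [now apply Rinv_0_lt_compat|]. nra.
Qed.

Lemma knot_le (s i j : nat) : (i <= j)%nat -> (j <= s)%nat -> knot s j <= knot s i.
Proof.
  intros Hij Hj. destruct (Nat.eq_dec i j) as [->|H]; [lra|].
  left. apply knot_lt; lia.
Qed.

Lemma sum_single (f : nat -> R) (k n : nat) : (k <= n)%nat ->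
  (forall i, (i <= n)%nat -> i <> k -> f i = 0) -> sum_f_R0 f n = f k.
Proof.
  intros Hk H. induction n as [|n IH].
  - replace k with 0%nat by lia. reflexivity.
  - rewrite tech5. destruct (Nat.eq_dec k (S n)) as [->|Hne].
    + rewrite (sum_eq _ (fun _ => 0)), sum_cte; [ring|].
      intros i Hi. apply H; lia.
    + rewrite (H (S n)), IH by (lia || (intros; apply H; lia)). ring.
Qed.

(** Truncated powers at knots to the right of the interval do not change and those at knots to the
    left all grow by [b - a], so only the summand that straddles the interval contributes. *)
Lemma spl_1_affine (s k : nat) (a b : R) : (k < s)%nat ->
  knot s (S k) <= a -> a < b -> b <= knot s k ->
  spl s 1 b - spl s 1 a = (-1) ^ S k * (b - a).
Proof.
  intros Hk Ha Hab Hb.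
  pose (d := fun j => tpow 1 (b - knot s j) - tpow 1 (a - knot s j)).
  assert (D0 : forall j, (j <= k)%nat -> d j = 0).
  { intros j Hj. unfold d. pose proof (knot_le s j k Hj). 
    rewrite !tpow_neg; [ring| |]; assert (knot s k <= knot s j) by (apply knot_le; lia); lra. }
  assert (D1 : forall j, (k < j)%nat -> (j <= s)%nat -> d j = b - a).
  { intros j Hj Hjs. assert (knot s j <= knot s (S k)) by (apply knot_le; lia).
    unfold d. rewrite !tpow_nonneg_arg by (lia || lra). simpl. field. }
  replace (spl s 1 b - spl s 1 a)
    with (sum_f_R0 (fun j => (-1) ^ j * (d j - d (j + 1)%nat)) (s - 1)).
  - rewrite (sum_single _ k); [|lia|].
    + rewrite D0, D1 by lia. simpl. ring.
    + intros i Hi Hne. destruct (le_lt_dec i k).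
      * rewrite !D0 by lia. ring.
      * rewrite !D1 by lia. ring.
  - unfold spl, altdiff, d. rewrite <- minus_sum. apply sum_eq. intros; ring.
Qed.

(** [spl s 1] has slope 1 or -1 on each of the [s] knot intervals, so no two zeros share one.
    Inductively [z i] lies at or beyond [knot s (s - i)], strictly for [i > 0], and the last zero
    would exceed 1. *)
Lemma spl_no_long_chain (s : nat) : (1 <= s)%nat -> ~ zero_chain (spl s 1) s.
Proof.
  intros Hs (z & Hz0 & Hzn & Hinc & Hz).
  assert (St : forall i, (i < s)%nat -> knot s (s - i) <= z i -> knot s (s - S i) < z (S i)).
  { intros i Hi Hzi. apply Rnot_le_lt. intros Hc.
    assert (E := spl_1_affine s (s - S i) (z i) (z (S i))).
    replace (S (s - S i)) with (s - i)%nat in E by lia.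
    specialize (E ltac:(lia) Hzi (Hinc i Hi) Hc). rewrite !Hz in E by lia.
    specialize (Hinc i Hi).
    assert (H : Rabs (0 - 0) = Rabs ((-1) ^ (s - i) * (z (S i) - z i))) by now rewrite E.
    rewrite Rabs_mult, pow_1_abs, Rminus_0_r, Rabs_R0, Rabs_pos_eq in H by lra. lra. }
  assert (Q : forall i, (i <= s)%nat -> knot s (s - i) <= z i).
  { induction i as [|i IH]; intros Hi.
    - rewrite Nat.sub_0_r, knot_last, Hz0 by exact Hs. lra.
    - left. apply St; [lia|]. apply IH. lia. }
  pose proof (St (s - 1)%nat ltac:(lia) (Q (s - 1)%nat ltac:(lia))) as H.
  replace (S (s - 1)) with s in H by lia.
  rewrite Nat.sub_diag, knot_0, Hzn in H. lra.
Qed.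

Lemma spl_chain_descend (s j : nat) : (3 <= s)%nat -> (j + 2 <= s)%nat ->
  zero_chain (spl s (s - 1)) 2 -> zero_chain (spl s (s - 1 - j)) (2 + j).
Proof.
  intros Hs Hj H. induction j as [|j IH].
  - now rewrite Nat.sub_0_r, Nat.add_0_r.
  - replace (2 + S j)%nat with (S (2 + j)) by lia.
    apply (zero_chain_deriv (spl s (s - 1 - j))); [lia| | | |apply IH; lia].
    + intros x. destruct (s - 1 - j)%nat as [|[|r]] eqn:E; [lia|lia|].
      replace (s - 1 - S j)%nat with (S r) by lia. apply spl_deriv.
    + apply spl_left. lra.
    + apply spl_right; lia || lra.
Qed.

(** A zero inside would give the chain [-1, x, 1]; after [s - 2] differentiations it would have [s]
    intervals, too many for the piecewise linear [spl s 1]. *)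
Lemma spl_neq0 (s : nat) (x : R) : (3 <= s)%nat -> -1 < x < 1 -> spl s (s - 1) x <> 0.
Proof.
  intros Hs Hx H. apply (spl_no_long_chain s ltac:(lia)).
  replace (spl s 1) with (spl s (s - 1 - (s - 2))) by (f_equal; lia).
  replace s with (2 + (s - 2))%nat at 4 by lia.
  apply spl_chain_descend; [lia|lia|].
  exists (fun i => match i with O => -1 | 1%nat => x | _ => 1 end).
  repeat split.
  - intros [|[|i]] Hi; simpl; lra || lia.
  - intros [|[|[|i]]] Hi; simpl; try lia; auto.
    + apply spl_left. lra.
    + apply spl_right; lia || lra.
Qed.

Lemma spl_near_left (s : nat) (x : R) : (2 <= s)%nat -> Nat.Even s ->
  -1 < x <= knot s (s - 1) -> 0 < spl s (s - 1) x.
Proof.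
  intros Hs [k Hk] Hx. unfold spl, altdiff.
  rewrite (sum_single _ (s - 1)); [|lia|].
  - replace (s - 1 + 1)%nat with s by lia. rewrite knot_last by lia.
    rewrite (tpow_neg _ (x - knot s (s - 1))), tpow_pos by lra.
    replace (s - 1)%nat with (S (2 * (k - 1))) at 1 by lia. rewrite pow_1_odd.
    assert (0 < (x - -1) ^ (s - 1) / INR (fact (s - 1))); [|lra].
    apply Rdiv_lt_0_compat; [apply pow_lt; lra|apply INR_fact_lt_0].
  - intros i Hi Hne.
    assert (knot s (s - 1) <= knot s i) by (apply knot_le; lia).
    assert (knot s (s - 1) <= knot s (i + 1)) by (apply knot_le; lia).
    rewrite !tpow_neg by lra. ring.
Qed.

(** The spline has no interior zero and is positive near [-1], so a negative value would contradict
    the intermediate value theorem. *)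
Lemma spl_ge0 (s : nat) (x : R) : (3 <= s)%nat -> Nat.Even s -> 0 <= spl s (s - 1) x.
Proof.
  intros Hs He. destruct (Rle_dec x (-1)) as [H1|H1]; [rewrite spl_left; lra|].
  destruct (Rle_dec 1 x) as [H2|H2]; [rewrite spl_right; lra || lia|].
  apply Rnot_lt_le. intros Hneg.
  destruct (Rle_dec x (knot s (s - 1))) as [H3|H3].
  - pose proof (spl_near_left s x ltac:(lia) He ltac:(lra)). lra.
  - assert (Hk : -1 < knot s (s - 1)) by (rewrite <- (knot_last s) by lia; apply knot_lt; lia).
    pose proof (spl_near_left s (knot s (s - 1)) ltac:(lia) He ltac:(lra)) as Hp.
    destruct (IVT (fun y => - spl s (s - 1) y) (knot s (s - 1)) x) as [z [Hz1 Hz2]]; try lra.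
    + apply (continuity_opp (spl s (s - 1))). apply derivable_continuous. intros y.
      destruct (s - 1)%nat as [|[|r]] eqn:E; [lia|lia|].
      exists (spl s (S r) y). apply spl_deriv.
    + apply (spl_neq0 s z Hs); lra.
Qed.

(** * The integral defining [g] *)

Section ChiIntegral.
Import Coquelicot.Coquelicot.

Lemma RInt_of_is_RInt (f : R -> R) (a b v : R) : is_RInt f a b v -> Defs.RInt f a b = v.
Proof.
  intros H. unfold Defs.RInt.
  destruct (excluded_middle_informative _) as [h|h].
  - rewrite <- RInt_Reals. now apply is_RInt_unique.
  - exfalso. apply h. constructor. apply ex_RInt_Reals_0. now exists v.
Qed.

Lemma is_RInt_reflected_pow (x p q : R) (n : nat) : p <= q -> q <= x ->
  is_RInt (fun t => (x - t) ^ n) p q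
    (INR (fact n) * (tpow (S n) (x - p) - tpow (S n) (x - q))).
Proof.
  intros Hp Hq.
  assert (Hn : INR (S n) <> 0) by now apply not_0_INR.
  replace (INR (fact n) * (tpow (S n) (x - p) - tpow (S n) (x - q)))
    with (minus (- ((x - q) ^ S n / INR (S n))) (- ((x - p) ^ S n / INR (S n)))).
  - apply (is_RInt_derive (fun t => - ((x - t) ^ S n / INR (S n)))).
    + intros t _. auto_derive; [trivial|]. 
      change (match n with 0%nat => 1 | S _ => INR n + 1 end) with (INR (S n)). simpl pred.
      unfold Rminus. generalize ((x + - t) ^ n), (INR (S n)), Hn. intros; field; auto.
    + intros t _. apply (ex_derive_continuous (K := R_AbsRing) (V := R_NormedModule) (fun t => (x - t) ^ n)).
      auto_derive. trivial.
  - rewrite !tpow_nonneg_arg by (lia || lra).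
    rewrite fact_simpl, mult_INR. 
    unfold minus, plus, opp; cbn -[INR fact pow].
    generalize (INR_fact_neq_0 n). revert Hn.
    generalize (INR (S n)), (INR (fact n)), ((x - p) ^ S n), ((x - q) ^ S n).
    intros; field; auto.
Qed.

Lemma is_RInt_zero (f : R -> R) (a b : R) : a <= b ->
  (forall t, a < t < b -> f t = 0) -> is_RInt f a b 0.
Proof.
  intros Hab H. apply (is_RInt_ext (fun _ => 0)).
  - intros t. rewrite Rmin_left, Rmax_right by exact Hab. intros Ht. now rewrite H.
  - pose proof (is_RInt_const (V := R_NormedModule) a b 0) as K.
    change (scal (b - a) 0) with ((b - a) * 0) in K. now rewrite Rmult_0_r in K.
Qed.

Lemma is_RInt_join (f : R -> R) (a b c v w : R) :
  is_RInt f a b v -> is_RInt f b c w -> is_RInt f a c (v + w).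
Proof. intros H1 H2. exact (is_RInt_Chasles f a b c v w H1 H2). Qed.

(** One formula covers the three positions of [x] relative to [[a, b]], since the truncated powers
    at endpoints beyond [x] vanish. *)
Lemma is_RInt_chi (a b x : R) (n : nat) : -1 <= a -> a <= b -> -1 <= x ->
  is_RInt (fun t => chi a b t * (x - t) ^ n) (-1) x
    (INR (fact n) * (tpow (S n) (x - a) - tpow (S n) (x - b))).
Proof.
  intros Ha Hab Hx.
  assert (Z1 : forall t, t <= a -> chi a b t * (x - t) ^ n = 0).
  { intros t Ht. unfold chi. destruct (Rlt_dec a t); [lra|ring]. }
  assert (Z2 : forall t, b < t -> chi a b t * (x - t) ^ n = 0).
  { intros t Ht. unfold chi. destruct (Rlt_dec a t); [|ring].
    destruct (Rle_dec t b); [lra|ring]. }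
  assert (Z3 : forall t, a < t <= b -> (x - t) ^ n = chi a b t * (x - t) ^ n).
  { intros t Ht. unfold chi. destruct (Rlt_dec a t); [|lra].
    destruct (Rle_dec t b); [ring|lra]. }
  destruct (Rle_dec x a) as [H1|H1].
  - rewrite !tpow_neg by lra. replace (_ * (0 - 0)) with 0 by ring.
    apply is_RInt_zero; [lra|]. intros; apply Z1; lra.
  - rewrite <- (Rplus_0_l (INR (fact n) * _)).
    apply is_RInt_join with a.
    { apply is_RInt_zero; [lra|]. intros; apply Z1; lra. }
    destruct (Rle_dec x b) as [H2|H2].
    + apply (is_RInt_ext (fun t => (x - t) ^ n)).
      * intros t. rewrite Rmin_left, Rmax_right by lra. intros Ht. apply Z3. lra.
      (* For [x <= b] the truncated power at [b] is zero, and so is the one at [x]; exchanging them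
         gives the formula for the interval [[a, x]]. *)
      * rewrite (tpow_neg _ (x - b)), <- (tpow_neg (S n) (x - x)) by lra.
        apply is_RInt_reflected_pow; lra.
    + rewrite <- (Rplus_0_r (INR (fact n) * _)).
      apply is_RInt_join with b.
      * apply (is_RInt_ext (fun t => (x - t) ^ n)).
        -- intros t. rewrite Rmin_left, Rmax_right by lra. intros Ht. apply Z3. lra.
        -- apply is_RInt_reflected_pow; lra.
      * apply is_RInt_zero; [lra|]. intros; apply Z2; lra.
Qed.

Lemma is_RInt_sum (f : nat -> R -> R) (v : nat -> R) (a b : R) (n : nat) :
  (forall k, (k <= n)%nat -> is_RInt (f k) a b (v k)) ->
  is_RInt (fun t => sum_f_R0 (fun k => f k t) n) a b (sum_f_R0 v n).
Proof.
  induction n as [|n IH]; intros H.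
  - apply (H 0%nat). lia.
  - simpl. apply (is_RInt_plus (V := R_NormedModule) (fun t => sum_f_R0 (fun k => f k t) n) (f (S n))).
    + apply IH. intros; apply H; lia.
    + apply H. lia.
Qed.

(** Integrating indicator by indicator yields truncated powers of degree [s - 1]. The prefactor
    cancels [(s - 2)!], and its sign, [-1] for even [s], reverses the differences into those of
    [altdiff]. *)
Lemma g_spl (s : nat) (x : R) : (6 <= s)%nat -> Nat.Even s -> g s x = spl s (s - 1) x.
Proof.
  intros Hs [k Hk]. unfold g.
  destruct (Rle_dec (-1) x) as [H1|H1]; [|now rewrite spl_left by lra].
  destruct (Rle_dec x 1) as [H2|H2]; [|now rewrite spl_right by (lia || lra)].
  rewrite (RInt_of_is_RInt _ _ _
    (sum_f_R0 (fun k => (-1) ^ k * (INR (fact (s - 2)) *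
       (tpow (s - 1) (x - knot s (k + 1)) - tpow (s - 1) (x - knot s k)))) (s - 1))).
  - replace (s - 1)%nat with (S (2 * (k - 1))) at 1 by lia. rewrite pow_1_odd.
    unfold spl, altdiff. rewrite scal_sum. apply sum_eq. intros i _.
    field. apply INR_fact_neq_0.
  - apply (is_RInt_ext (fun t => sum_f_R0 (fun k => (-1) ^ k *
      (chi (knot s (k + 1)) (knot s k) t * (x - t) ^ (s - 2))) (s - 1))).
    + intros t _. rewrite (Rmult_comm (sum_f_R0 _ _)), scal_sum. apply sum_eq.
      intros i _. unfold knot. ring.
    + apply (is_RInt_sum (fun k t => (-1) ^ k *
        (chi (knot s (k + 1)) (knot s k) t * (x - t) ^ (s - 2)))).
      intros i Hi. apply (is_RInt_scal (V := R_NormedModule)).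
      replace (s - 1)%nat with (S (s - 2)) by lia.
      apply is_RInt_chi; [apply COS_bound|apply knot_le; lia|exact H1].
Qed.

End ChiIntegral.

(** * Cardinal B-splines and trigonometric sums *)

Fixpoint bdiff (n : nat) (f : R -> R) (x : R) : R :=
  match n with
  | O => f x
  | S n => bdiff n f x - bdiff n f (x - 1)
  end.

Lemma bdiff_ext (n : nat) (f h : R -> R) : (forall x, f x = h x) ->
  forall x, bdiff n f x = bdiff n h x.
Proof. intros H. induction n; intros x; simpl; [apply H|]. now rewrite !IHn. Qed.

Lemma bdiff_plus (n : nat) (f h : R -> R) (x : R) :
  bdiff n (fun y => f y + h y) x = bdiff n f x + bdiff n h x.
Proof. revert x. induction n; intros x; simpl; [ring|]. rewrite !IHn. ring. Qed.

Lemma bdiff_scal (n : nat) (c : R) (f : R -> R) (x : R) :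
  bdiff n (fun y => c * f y) x = c * bdiff n f x.
Proof. revert x. induction n; intros x; simpl; [ring|]. rewrite !IHn. ring. Qed.

Lemma bdiff_shift (n : nat) (z : R) (f : R -> R) (x : R) :
  bdiff n (fun y => f (y - z)) x = bdiff n f (x - z).
Proof.
  revert x. induction n; intros x; simpl; [ring|].
  rewrite !IHn. do 2 f_equal. ring.
Qed.

Lemma bdiff_add (a b : nat) (f : R -> R) (x : R) :
  bdiff (a + b) f x = bdiff a (bdiff b f) x.
Proof. revert x. induction a; intros x; simpl; [reflexivity|]. now rewrite !IHa. Qed.

(** The Leibniz rule for a linear factor, whose second difference vanishes. *)
Lemma bdiff_mul_id (n : nat) (f : R -> R) (x : R) :
  bdiff (S n) (fun y => y * f y) x
  = x * bdiff (S n) f x + INR (S n) * bdiff n f (x - 1).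
Proof.
  revert x. induction n as [|n IH]; intros x.
  - simpl. ring.
  - change (bdiff (S (S n)) (fun y => y * f y) x) with
      (bdiff (S n) (fun y => y * f y) x - bdiff (S n) (fun y => y * f y) (x - 1)).
    rewrite !IH, (S_INR (S n)). simpl bdiff. ring.
Qed.

Lemma bdiff_left (n : nat) (f : R -> R) : (forall x, x <= 0 -> f x = 0) ->
  forall x, x <= 0 -> bdiff n f x = 0.
Proof.
  intros H. induction n as [|n IH]; intros x Hx; simpl; [now apply H|].
  rewrite !IH by lra. ring.
Qed.

Lemma bdiff_right (n : nat) (f : R -> R) (a : R) : (forall x, a <= x -> f x = 0) ->
  forall x, a + INR n <= x -> bdiff n f x = 0.
Proof.
  intros H. induction n as [|n IH]; intros x Hx.
  - simpl in *. apply H. lra.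
  - rewrite S_INR in Hx. simpl. rewrite !IH by lra. ring.
Qed.

(** The cardinal B-spline of degree [r] with knots [0, ..., r + 1]. For [r = 0] it is the indicator
    of [(0, 1]]. *)
Definition bspline (r : nat) (x : R) : R := bdiff (S r) (tpow r) x.

(** The Leibniz rule applied to [y tpow r y = (r + 1) tpow (r + 1) y]. *)
Lemma bspline_cox_de_boor (r : nat) (x : R) :
  INR (S r) * bspline (S r) x = x * bspline r x + (INR (S (S r)) - x) * bspline r (x - 1).
Proof.
  unfold bspline. rewrite <- bdiff_scal.
  rewrite (bdiff_ext _ _ (fun y => y * tpow r y)) by (intros; symmetry; apply tpow_mul).
  rewrite bdiff_mul_id. simpl bdiff. ring.
Qed.

Lemma bspline_left (r : nat) (x : R) : x <= 0 -> bspline r x = 0.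
Proof. apply bdiff_left. intros; now apply tpow_neg. Qed.

Lemma bspline_0 (x : R) : bspline 0 x = if Rlt_dec 0 x then (if Rle_dec x 1 then 1 else 0) else 0.
Proof.
  unfold bspline, bdiff, tpow. simpl.
  destruct (Rlt_dec 0 x), (Rlt_dec 0 (x - 1)), (Rle_dec x 1); lra.
Qed.

Lemma bspline_right (r : nat) (x : R) : INR (S r) < x -> bspline r x = 0.
Proof.
  revert x. induction r as [|r IH]; intros x Hx.
  - simpl in Hx. rewrite bspline_0. destruct (Rlt_dec 0 x), (Rle_dec x 1); lra.
  - apply (Rmult_eq_reg_l (INR (S r))); [|now apply not_0_INR].
    rewrite (S_INR (S r)) in Hx. rewrite bspline_cox_de_boor, !IH by lra. ring.
Qed.

Lemma bspline_ge0 (r : nat) (x : R) : 0 <= bspline r x.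
Proof.
  revert x. induction r as [|r IH]; intros x.
  - rewrite bspline_0. destruct (Rlt_dec 0 x), (Rle_dec x 1); lra.
  - destruct (Rle_dec x 0) as [H|H]; [rewrite bspline_left; lra|].
    destruct (Rlt_dec (INR (S (S r))) x) as [H'|H']; [rewrite bspline_right; lra|].
    apply (Rmult_le_reg_l (INR (S r))); [apply lt_0_INR; lia|].
    rewrite bspline_cox_de_boor, Rmult_0_r.
    apply Rplus_le_le_0_compat; apply Rmult_le_pos; try apply IH; lra.
Qed.

Lemma bspline_partition (r : nat) (z : R) (M : nat) : 0 <= z -> z + INR (S r) < INR M ->
  sum_f_R0 (fun j => bspline r (INR j - z)) M = 1.
Proof.
  intros Hz. revert M. induction r as [|r IH]; intros M HM.
  - destruct (archimed z) as [A1 A2].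
    assert (Hup : (0 < up z)%Z) by (apply lt_IZR; simpl; lra).
    pose (k := Z.to_nat (up z)).
    assert (Hk : INR k = IZR (up z)) by (unfold k; rewrite INR_IZR_INZ, Z2Nat.id by lia; reflexivity).
    rewrite (sum_single _ k).
    + rewrite bspline_0, Hk. destruct (Rlt_dec 0 (IZR (up z) - z)); [|lra].
      destruct (Rle_dec (IZR (up z) - z) 1); lra.
    + apply INR_le. simpl in HM. lra.
    + intros i Hi Hne. rewrite bspline_0.
      destruct (Rlt_dec 0 (INR i - z)); [|reflexivity].
      destruct (Rle_dec (INR i - z) 1); [|reflexivity].
      exfalso. apply Hne.
      assert (H1 : (i < S k)%nat) by (apply INR_lt; rewrite S_INR; lra).
      assert (H2 : (k < S i)%nat) by (apply INR_lt; rewrite S_INR; lra).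
      lia.
  - rewrite (S_INR (S r)) in HM.
    assert (Hr : INR (S r) <> 0) by now apply not_0_INR.
    (* In the summed recursion the two coefficients of [bspline r (j - z)] add up to [r + 1]; the
       subtracted term is the share of [j = n] that only index [n + 1] would supply. *)
    assert (E : forall n, INR (S r) * sum_f_R0 (fun j => bspline (S r) (INR j - z)) n
      = INR (S r) * sum_f_R0 (fun j => bspline r (INR j - z)) n
        - (INR (S r) - (INR n - z)) * bspline r (INR n - z)).
    { induction n as [|n IHn].
      - cbn [sum_f_R0]. rewrite bspline_cox_de_boor.
        rewrite (bspline_left r (INR 0 - z - 1)), (bspline_left r (INR 0 - z)) by (simpl; lra). ring.
      - rewrite !tech5, Rmult_plus_distr_l, IHn, bspline_cox_de_boor.
        replace (INR (S n) - z - 1) with (INR n - z) by (rewrite S_INR; ring).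
        rewrite (S_INR n), (S_INR (S r)). ring. }
    apply (Rmult_eq_reg_l (INR (S r))); [|exact Hr].
    rewrite E, (bspline_right r (INR M - z)), IH by lra. ring.
Qed.

(** The free phase covers cosine and sine sums at once and absorbs the argument of every complex
    factor. *)
Definition tsum (M : nat) (tau phi : R) (f : R -> R) : R :=
  sum_f_R0 (fun j => f (INR j) * cos (INR j * tau + phi)) M.

Lemma tsum_plus (M : nat) (tau phi : R) (f h : R -> R) :
  tsum M tau phi (fun x => f x + h x) = tsum M tau phi f + tsum M tau phi h.
Proof. unfold tsum. rewrite <- sum_plus. apply sum_eq. intros; ring. Qed.

Lemma tsum_scal (M : nat) (tau phi c : R) (f : R -> R) :
  tsum M tau phi (fun x => c * f x) = c * tsum M tau phi f.
Proof. unfold tsum. rewrite scal_sum. apply sum_eq. intros; ring. Qed.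

Lemma tsum_ext (M : nat) (tau phi : R) (f h : R -> R) :
  (forall x, f x = h x) -> tsum M tau phi f = tsum M tau phi h.
Proof. intros H. apply sum_eq. intros; now rewrite H. Qed.

Lemma tsum_tail (M M' : nat) (tau phi : R) (f : R -> R) : (M <= M')%nat ->
  (forall x, INR M < x -> f x = 0) -> tsum M' tau phi f = tsum M tau phi f.
Proof.
  intros HM H. induction HM as [|M' HM IH]; [reflexivity|].
  change (tsum (S M') tau phi f)
    with (tsum M' tau phi f + f (INR (S M')) * cos (INR (S M') * tau + phi)).
  rewrite IH, H; [ring|].
  apply lt_INR. lia.
Qed.

(** Summation by parts with [1 - e^(i tau) = 2 sin (tau / 2) e^(i (tau / 2 - PI / 2))]. The last
    term is the boundary term at [M]; the left end gives none because [f] vanishes there. *)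
Lemma tsum_bdiff1 (M : nat) (tau phi : R) (f : R -> R) : (forall x, x <= 0 -> f x = 0) ->
  tsum M tau phi (bdiff 1 f)
  = 2 * sin (tau / 2) * tsum M tau (phi + (tau / 2 - PI / 2)) f
    + f (INR M) * cos (INR (S M) * tau + phi).
Proof.
  intros Hf.
  assert (E : forall x, cos x - cos (x + tau)
                        = 2 * sin (tau / 2) * cos (x + (tau / 2 - PI / 2))).
  { intros x. rewrite <- (cos_shift _), (form2 x (x + tau)).
    replace ((x - (x + tau)) / 2) with (- (tau / 2)) by field. rewrite sin_neg.
    rewrite <- (cos_shift ((x + (x + tau)) / 2)).
    replace (PI / 2 - (x + (x + tau)) / 2) with (- (x + (tau / 2 - PI / 2))) by field.
    rewrite cos_neg, cos_shift. ring. }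
  induction M as [|M IH].
  - unfold tsum. simpl. rewrite !Hf by lra. ring.
  - unfold tsum in *. rewrite !tech5, IH. cbn [bdiff].
    replace (INR (S M) - 1) with (INR M) by (rewrite S_INR; ring).
    replace (INR (S (S M)) * tau + phi) with (INR (S M) * tau + phi + tau)
      by (rewrite !S_INR; ring).
    rewrite <- Rplus_assoc in *.
    pose proof (E (INR (S M) * tau + phi)) as E1.
    replace (INR (S M) * tau + (phi + (tau / 2 - PI / 2)))
      with (INR (S M) * tau + phi + (tau / 2 - PI / 2)) by ring.
    set (A := cos (INR (S M) * tau + phi)) in *.
    set (B := cos (INR (S M) * tau + phi + tau)) in *.
    rewrite Rmult_plus_distr_l.
    replace (2 * sin (tau / 2) * (f (INR (S M)) * cos (INR (S M) * tau + phi + (tau / 2 - PI / 2))))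
      with (f (INR (S M)) * (A - B)) by (rewrite E1; ring).
    ring.
Qed.

Lemma tsum_bdiff (n M : nat) (a tau phi : R) (f : R -> R) :
  (forall x, x <= 0 -> f x = 0) -> (forall x, a <= x -> f x = 0) -> a + INR n <= INR M ->
  tsum M tau phi (bdiff n f)
  = (2 * sin (tau / 2)) ^ n * tsum M tau (phi + INR n * (tau / 2 - PI / 2)) f.
Proof.
  intros Hl Hr. revert phi. induction n as [|n IH]; intros phi HM.
  - simpl. rewrite Rmult_0_l, Rplus_0_r, Rmult_1_l. reflexivity.
  - rewrite S_INR in HM.
    change (bdiff (S n) f) with (bdiff 1 (bdiff n f)).
    rewrite tsum_bdiff1 by (apply bdiff_left; exact Hl).
    rewrite (bdiff_right n f a Hr) by lra. rewrite IH by lra.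
    replace (phi + (tau / 2 - PI / 2) + INR n * (tau / 2 - PI / 2))
      with (phi + INR (S n) * (tau / 2 - PI / 2)) by (rewrite S_INR; ring).
    simpl pow. ring.
Qed.

(* [f] need not have compact support: the bound [B] is only tested on
   sufficiently high differences of [f]. *)
Definition tbound (tau : R) (f : R -> R) (B : R) : Prop :=
  (forall x, x <= 0 -> f x = 0) /\
  exists n0, forall n, (n0 <= n)%nat -> exists M0, forall M phi, (M0 <= M)%nat ->
    Rabs (tsum M tau phi (bdiff n f)) <= Rabs (2 * sin (tau / 2)) ^ n * B.

Lemma tbound_plus (tau B C : R) (f h : R -> R) :
  tbound tau f B -> tbound tau h C -> tbound tau (fun x => f x + h x) (B + C).
Proof.
  intros [Hf [n1 H1]] [Hh [n2 H2]]. split.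
  - intros x Hx. rewrite Hf, Hh by exact Hx. ring.
  - exists (Nat.max n1 n2). intros n Hn.
    destruct (H1 n ltac:(lia)) as [M1 K1]. destruct (H2 n ltac:(lia)) as [M2 K2].
    exists (Nat.max M1 M2). intros M phi HM.
    rewrite (tsum_ext _ _ _ _ _ (bdiff_plus n f h)), tsum_plus.
    eapply Rle_trans; [apply Rabs_triang|]. rewrite Rmult_plus_distr_l.
    apply Rplus_le_compat; [apply K1|apply K2]; lia.
Qed.

Lemma tbound_scal (tau B c : R) (f : R -> R) :
  tbound tau f B -> tbound tau (fun x => c * f x) (Rabs c * B).
Proof.
  intros [Hf [n1 H1]]. split.
  - intros x Hx. rewrite Hf by exact Hx. ring.
  - exists n1. intros n Hn. destruct (H1 n Hn) as [M1 K1].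
    exists M1. intros M phi HM.
    rewrite (tsum_ext _ _ _ _ _ (bdiff_scal n c f)), tsum_scal, Rabs_mult.
    specialize (K1 M phi HM). pose proof (Rabs_pos c). nra.
Qed.

Lemma tbound_ext (tau B : R) (f h : R -> R) : (forall x, f x = h x) ->
  tbound tau f B -> tbound tau h B.
Proof.
  intros E [Hf [n1 H1]]. split.
  - intros x Hx. rewrite <- E. now apply Hf.
  - exists n1. intros n Hn. destruct (H1 n Hn) as [M1 K1].
    exists M1. intros M phi HM.
    rewrite <- (tsum_ext _ _ _ _ _ (bdiff_ext n _ _ E)). now apply K1.
Qed.

Lemma tbound_le (tau B C : R) (f : R -> R) : B <= C -> tbound tau f B -> tbound tau f C.
Proof.
  intros HB [Hf [n1 H1]]. split; [exact Hf|].
  exists n1. intros n Hn. destruct (H1 n Hn) as [M1 K1].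
  exists M1. intros M phi HM. eapply Rle_trans; [now apply K1|].
  apply Rmult_le_compat_l; [apply pow_le, Rabs_pos|exact HB].
Qed.

Lemma tbound_sum (tau : R) (f : nat -> R -> R) (B : nat -> R) (n : nat) :
  (forall k, (k <= n)%nat -> tbound tau (f k) (B k)) ->
  tbound tau (fun x => sum_f_R0 (fun k => f k x) n) (sum_f_R0 B n).
Proof.
  induction n as [|n IH]; intros H.
  - apply (H 0%nat). lia.
  - simpl. apply tbound_plus; [apply IH; intros; apply H; lia|apply H; lia].
Qed.

Lemma bspline_tsum (r M : nat) (z tau phi : R) : 0 <= z -> z + INR (S r) < INR M ->
  Rabs (tsum M tau phi (fun x => bspline r (x - z))) <= 1.
Proof.
  intros Hz HM. rewrite <- (bspline_partition r z M Hz HM).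
  unfold tsum. eapply Rle_trans; [apply Rsum_abs|]. apply sum_Rle. intros k _.
  rewrite Rabs_mult, Rabs_pos_eq by apply bspline_ge0.
  rewrite <- (Rmult_1_r (bspline r (INR k - z))) at 2.
  apply Rmult_le_compat_l; [apply bspline_ge0|].
  apply Rabs_le. apply COS_bound.
Qed.

(** [r + 1] of the differences make a cardinal B-spline, whose sum is at most 1 in modulus; each of
    the other [q] contributes exactly one factor [2 sin (tau / 2)]. *)
Lemma tbound_tpow (tau z : R) (r : nat) : 0 <= z -> sin (tau / 2) <> 0 ->
  tbound tau (fun x => tpow r (x - z)) (/ Rabs (2 * sin (tau / 2)) ^ S r).
Proof.
  intros Hz Hs. split; [intros; apply tpow_neg; lra|].
  exists (S r). intros n Hn.
  pose (q := (n - S r)%nat).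
  destruct (INR_unbounded (z + INR (S r) + 1 + INR q)) as [M0 HM0].
  exists M0. intros M phi HM. apply le_INR in HM.
  rewrite (tsum_ext _ _ _ _ (bdiff q (fun x => bspline r (x - z)))).
  - rewrite (tsum_bdiff q M (z + INR (S r) + 1)).
    + rewrite Rabs_mult, <- RPow_abs.
      replace n with (q + S r)%nat by (unfold q; lia).
      rewrite pow_add, Rmult_assoc, Rinv_r, Rmult_1_r.
      * rewrite <- (Rmult_1_r (Rabs (2 * sin (tau / 2)) ^ q)) at 2.
        apply Rmult_le_compat_l; [apply pow_le, Rabs_pos|].
        apply bspline_tsum; [exact Hz|]. pose proof (pos_INR q). lra.
      * apply pow_nonzero, Rabs_no_R0. lra.
    + intros x Hx. apply bspline_left. lra.
    + intros x Hx. apply bspline_right. lra.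
    + lra.
  - intros x. replace n with (q + S r)%nat by (unfold q; lia).
    rewrite bdiff_add. apply bdiff_ext. intros y. apply bdiff_shift.
Qed.

(** Once [f] has compact support, the differences can be undone by dividing by
    [|2 sin (tau / 2)|^n]. Hence the bounds for single truncated powers, whose supports are
    unbounded, may be added first. *)
Lemma tbound_tsum (tau phi B : R) (f : R -> R) (M : nat) : sin (tau / 2) <> 0 ->
  tbound tau f B -> (forall x, INR M < x -> f x = 0) ->
  Rabs (tsum M tau phi f) <= B.
Proof.
  intros Hs [Hl [n H]] Hr. destruct (H n (le_n n)) as [M0 K].
  destruct (INR_unbounded (INR M + 1 + INR n)) as [M1 HM1].
  set (M2 := Nat.max M0 M1).
  assert (HM2 : INR M + 1 + INR n < INR M2).
  { eapply Rlt_le_trans; [exact HM1|]. apply le_INR. unfold M2. lia. }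
  specialize (K M2 (phi - INR n * (tau / 2 - PI / 2)) ltac:(unfold M2; lia)).
  rewrite (tsum_bdiff n M2 (INR M + 1)) in K by (auto || lra || (intros; apply Hr; lra)).
  replace (phi - INR n * (tau / 2 - PI / 2) + INR n * (tau / 2 - PI / 2)) with phi in K by ring.
  rewrite Rabs_mult, <- RPow_abs in K.
  rewrite <- (tsum_tail M M2 tau phi f).
  - apply (Rmult_le_reg_l (Rabs (2 * sin (tau / 2)) ^ n)); [|exact K].
    apply pow_lt, Rabs_pos_lt. lra.
  - apply INR_le. pose proof (pos_INR n). lra.
  - exact Hr.
Qed.

(** * Averaging over roots of unity *)

Lemma sum_swap (f : nat -> nat -> R) (m n : nat) :
  sum_f_R0 (fun i => sum_f_R0 (fun j => f i j) n) m
  = sum_f_R0 (fun j => sum_f_R0 (fun i => f i j) m) n.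
Proof.
  induction m as [|m IH]; [reflexivity|].
  rewrite tech5, IH, <- sum_plus. apply sum_eq. intros; now rewrite tech5.
Qed.

Lemma cos_sum_telescope (a x : R) (n : nat) :
  2 * sin (a / 2) * sum_f_R0 (fun i => cos (x + INR i * a)) n
  = sin (x + (INR n + / 2) * a) - sin (x - a / 2).
Proof.
  assert (E : forall y, 2 * sin (a / 2) * cos y = sin (y + a / 2) - sin (y - a / 2)).
  { intros y. rewrite sin_plus, sin_minus. ring. }
  induction n as [|n IH].
  - simpl. rewrite E. do 2 f_equal; field.
  - rewrite tech5, Rmult_plus_distr_l, IH, E, S_INR.
    replace (x + (INR n + 1) * a + a / 2) with (x + (INR n + 1 + / 2) * a) by field.
    replace (x + (INR n + 1) * a - a / 2) with (x + (INR n + / 2) * a) by field. ring.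
Qed.

(** The frequencies [(t + 2 pi j) / n] with [n = 2 m + 1] and [j = i - m]. For [|t| <= PI] and
    [i <= 2 m] they lie in [[-PI, PI]]. *)
Definition freq (m : nat) (t : R) (i : nat) : R :=
  (t + 2 * PI * (INR i - INR m)) / INR (2 * m + 1).

Lemma INR_odd (m : nat) : INR (2 * m + 1) = 2 * INR m + 1.
Proof. rewrite plus_INR, mult_INR. simpl. ring. Qed.

Lemma freq_sum_mult (m k : nat) (t phi : R) :
  sum_f_R0 (fun i => cos (INR ((2 * m + 1) * k) * freq m t i + phi)) (2 * m)
  = INR (2 * m + 1) * cos (INR k * t + phi).
Proof.
  assert (Hn : INR (2 * m + 1) <> 0) by (apply not_0_INR; lia).
  rewrite (sum_eq _ (fun _ => cos (INR k * t + phi))).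
  - rewrite sum_cte. replace (S (2 * m)) with (2 * m + 1)%nat by lia. ring.
  - intros i _. set (x := INR k * t + phi).
    (* The arguments differ by [2 PI k (i - m)], possibly negative, so each side is shifted by its
       own natural multiple of [2 PI]. *)
    rewrite <- (cos_period (INR ((2 * m + 1) * k) * freq m t i + phi) (k * m)).
    rewrite <- (cos_period x (k * i)). f_equal.
    unfold freq, x. rewrite !mult_INR. field. exact Hn.
Qed.

(** The sum telescopes to two sines whose arguments differ by [2 PI q], and [sin (PI q / n)] is
    nonzero because [n] does not divide [q]. *)
Lemma freq_sum_nonmult (m q : nat) (t phi : R) : (q mod (2 * m + 1) <> 0)%nat ->
  sum_f_R0 (fun i => cos (INR q * freq m t i + phi)) (2 * m) = 0.
Proof.
  intros Hq. pose proof PI_RGT_0 as Hpi.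
  assert (Hn : INR (2 * m + 1) <> 0) by (apply not_0_INR; lia).
  set (n := (2 * m + 1)%nat) in *.
  set (a := 2 * PI * INR q / INR n).
  set (x := INR q * (t - 2 * PI * INR m) / INR n + phi).
  assert (Ha : sin (a / 2) <> 0).
  { intros H0. apply sin_eq_0_0 in H0. destruct H0 as [k Hk]. apply Hq.
    assert (E : INR q = IZR k * INR n).
    { apply (Rmult_eq_reg_r PI); [|lra].
      replace (INR q * PI) with (a / 2 * INR n) by (unfold a; field; exact Hn).
      rewrite Hk. ring. }
    rewrite !INR_IZR_INZ, <- mult_IZR in E. apply eq_IZR in E.
    assert (0 <= k)%Z by nia.
    replace q with (Z.to_nat k * n)%nat by nia. apply Nat.Div0.mod_mul. }
  rewrite (sum_eq _ (fun i => cos (x + INR i * a))).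
  - apply (Rmult_eq_reg_l (2 * sin (a / 2))); [|lra].
    rewrite cos_sum_telescope, Rmult_0_r.
    replace (x + (INR (2 * m) + / 2) * a) with (x - a / 2 + 2 * INR q * PI).
    + rewrite sin_period. ring.
    + replace (INR (2 * m)) with (INR n - 1) by (unfold n; rewrite plus_INR; simpl; ring).
      unfold a. field. exact Hn.
  - intros i _. f_equal. unfold x, a, freq. fold n. field. exact Hn.
Qed.

Lemma sum_over_multiples (n : nat) (f : nat -> R) (K : nat) : (1 <= n)%nat ->
  (forall q, (q mod n <> 0)%nat -> f q = 0) ->
  sum_f_R0 f (n * K) = sum_f_R0 (fun k => f (n * k)%nat) K.
Proof.
  intros Hn Hf. induction K as [|K IH].
  - cbn [sum_f_R0]. now rewrite Nat.mul_0_r.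
  - rewrite tech5, <- IH.
    assert (E : forall d, (d < n)%nat -> sum_f_R0 f (n * K + d) = sum_f_R0 f (n * K)).
    { induction d as [|d IHd]; intros Hd; [now rewrite Nat.add_0_r|].
      rewrite Nat.add_succ_r, tech5, IHd by lia. rewrite Hf; [ring|].
      rewrite <- Nat.add_succ_r, Nat.mul_comm, Nat.add_comm, Nat.Div0.mod_add.
      rewrite Nat.mod_small by lia. lia. }
    replace (n * S K)%nat with (S (n * K + (n - 1))) by lia.
    rewrite tech5, E by lia. reflexivity.
Qed.

Lemma unity_filter (m K : nat) (t phi : R) (a : nat -> R) :
  sum_f_R0 (fun i => sum_f_R0 (fun q => a q * cos (INR q * freq m t i + phi))
                       ((2 * m + 1) * K)) (2 * m)
  = INR (2 * m + 1) *
    sum_f_R0 (fun k => a ((2 * m + 1) * k)%nat * cos (INR k * t + phi)) K.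
Proof.
  rewrite sum_swap, sum_over_multiples.
  - rewrite scal_sum. apply sum_eq. intros k _.
    rewrite (sum_eq _ (fun i => cos (INR ((2 * m + 1) * k) * freq m t i + phi) * a ((2 * m + 1) * k)%nat))
      by (intros; ring).
    rewrite <- scal_sum, freq_sum_mult. ring.
  - lia.
  - intros q Hq. rewrite (sum_eq _ (fun i => cos (INR q * freq m t i + phi) * a q))
      by (intros; ring).
    rewrite <- scal_sum, freq_sum_nonmult by exact Hq. ring.
Qed.

(** * Sums of the weighted spline on the fine grid *)

Definition rising (s i : nat) : R := INR (fact (s - 1 + i)) / INR (fact (s - 1)).

Lemma rising_pos (s i : nat) : 0 < rising s i.
Proof. apply Rdiv_lt_0_compat; apply INR_fact_lt_0. Qed.

Lemma binom_pos (l i : nat) : 0 < Binomial.C l i.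
Proof.
  unfold Binomial.C. apply Rdiv_lt_0_compat; [apply INR_fact_lt_0|].
  apply Rmult_lt_0_compat; apply INR_fact_lt_0.
Qed.

Lemma tpow_mul_pow (s i : nat) (x : R) :
  x ^ i * tpow (s - 1) x = rising s i * tpow (s - 1 + i) x.
Proof.
  unfold rising, tpow. destruct (Rlt_dec 0 x); [|ring].
  rewrite pow_add. field. split; apply INR_fact_neq_0.
Qed.

Definition sample (s l : nat) (d x : R) : R :=
  (-1 + d * x) ^ l * spl s (s - 1) (-1 + d * x).

Definition kern (s l i : nat) (d a : R) : R :=
  Binomial.C l i * rising s i * (d ^ (s - 1 + i) * / a ^ S (s - 1 + i)).

(** Writing [w = (w - y) + y] and expanding [w^l] merges each [(w - y)^i] with the truncated power
    into one of degree [s - 1 + i]; the powers of [y] are at most 1 in modulus. *)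
Lemma tbound_weighted_tpow (s l : nat) (d tau y : R) : 0 < d -> -1 <= y <= 1 ->
  sin (tau / 2) <> 0 ->
  tbound tau (fun x => (-1 + d * x) ^ l * tpow (s - 1) (-1 + d * x - y))
    (sum_f_R0 (fun i => kern s l i d (Rabs (2 * sin (tau / 2)))) l).
Proof.
  intros Hd Hy Hs.
  apply (tbound_ext tau _ (fun x => sum_f_R0 (fun i =>
    (Binomial.C l i * y ^ (l - i) * rising s i * d ^ (s - 1 + i))
    * tpow (s - 1 + i) (x - (1 + y) / d)) l)).
  - intros x. set (w := -1 + d * x).
    replace (w ^ l) with ((w - y + y) ^ l) by (f_equal; ring).
    rewrite binomial, Rmult_comm, scal_sum. apply sum_eq. intros i _.
    replace (Binomial.C l i * (w - y) ^ i * y ^ (l - i) * tpow (s - 1) (w - y))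
      with (Binomial.C l i * y ^ (l - i) * ((w - y) ^ i * tpow (s - 1) (w - y))) by ring.
    rewrite tpow_mul_pow.
    replace (w - y) with (d * (x - (1 + y) / d)) by (unfold w; field; lra).
    rewrite (tpow_scale _ d) by exact Hd. ring.
  - apply (tbound_sum tau (fun i x =>
      (Binomial.C l i * y ^ (l - i) * rising s i * d ^ (s - 1 + i))
      * tpow (s - 1 + i) (x - (1 + y) / d))).
    intros i _.
    eapply tbound_le; [|apply tbound_scal, tbound_tpow; [|exact Hs]].
    + unfold kern. set (a := Rabs (2 * sin (tau / 2))).
      assert (Ha : 0 < / a ^ S (s - 1 + i))
        by (apply Rinv_0_lt_compat, pow_lt, Rabs_pos_lt; lra).
      rewrite !Rabs_mult, <- RPow_abs.
      rewrite (Rabs_pos_eq (Binomial.C l i)) by (left; apply binom_pos).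
      rewrite (Rabs_pos_eq (rising s i)) by (left; apply rising_pos).
      rewrite (Rabs_pos_eq (d ^ _)) by (apply pow_le; lra).
      assert (Hp : Rabs y ^ (l - i) <= 1).
      { rewrite <- (pow1 (l - i)). apply pow_incr. split; [apply Rabs_pos|].
        apply Rabs_le. lra. }
      assert (H0 : 0 <= Binomial.C l i * rising s i * (d ^ (s - 1 + i) * / a ^ S (s - 1 + i))).
      { apply Rmult_le_pos; [|apply Rmult_le_pos; [apply pow_le|]; lra].
        apply Rmult_le_pos; left; [apply binom_pos|apply rising_pos]. }
      nra.
    + apply Rmult_le_pos; [lra|]. left. now apply Rinv_0_lt_compat.
Qed.

Lemma tbound_sample (s l : nat) (d tau : R) : (1 <= s)%nat -> 0 < d -> sin (tau / 2) <> 0 ->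
  tbound tau (sample s l d)
    (2 * INR s * sum_f_R0 (fun i => kern s l i d (Rabs (2 * sin (tau / 2)))) l).
Proof.
  intros Hs Hd Ht. set (B := sum_f_R0 _ _).
  pose (u := fun y x => (-1 + d * x) ^ l * tpow (s - 1) (-1 + d * x - y)).
  assert (Hu : forall y, -1 <= y <= 1 -> tbound tau (u y) B)
    by (intros; now apply tbound_weighted_tpow).
  apply (tbound_ext tau _ (fun x => sum_f_R0 (fun k =>
           (-1) ^ k * (u (knot s k) x + -1 * u (knot s (k + 1)%nat) x)) (s - 1))).
  - intros x. unfold sample, spl, altdiff, u. rewrite scal_sum. apply sum_eq. intros; ring.
  - apply (tbound_le tau (sum_f_R0 (fun _ => 2 * B) (s - 1))).
    + rewrite sum_cte. replace (S (s - 1)) with s by lia. lra.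
    + apply (tbound_sum tau (fun k x => (-1) ^ k * (u (knot s k) x + -1 * u (knot s (k + 1)%nat) x))
               (fun _ => 2 * B)).
      intros k _.
      eapply tbound_le; [|apply tbound_scal, tbound_plus;
        [apply Hu, COS_bound|apply tbound_scal, Hu, COS_bound]].
      rewrite pow_1_abs. rewrite Rabs_left by lra. lra.
Qed.

Lemma sample_right (s l n : nat) (d x : R) : (2 <= s)%nat -> 0 < d -> d * INR n = 2 ->
  INR n < x -> sample s l d x = 0.
Proof.
  intros Hs Hd Hn Hx. unfold sample. rewrite spl_right; [ring|lia|lia|nra].
Qed.

(** With [n = 2 m + 1], this is [n] times the chord length [|e^(i omega) - 1|] at the frequency
    [omega]. For fixed [j = i - m] it tends to [|t + 2 pi j|] as [m] grows. *)
Definition chord (m : nat) (t : R) (i : nat) : R :=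
  INR (2 * m + 1) * Rabs (2 * sin (freq m t i / 2)).

(** With [d = 1 / (n K)], the power [d^(s - 1 + j)] supplies all but one of the factors [n] that
    turn [s + j] sines into chords; the missing one is the factor [n] in front. *)
Lemma fine_sample_bound (s l m K i : nat) (t phi : R) :
  (2 <= s)%nat -> (1 <= K)%nat -> sin (freq m t i / 2) <> 0 ->
  Rabs (tsum ((2 * m + 1) * (2 * K)) (freq m t i) phi (sample s l (/ INR ((2 * m + 1) * K))))
  <= INR (2 * m + 1) * (2 * INR s * sum_f_R0 (fun j => kern s l j (/ INR K) (chord m t i)) l).
Proof.
  intros Hs HK Hi.
  assert (Hn0 : 0 < INR (2 * m + 1)) by (apply lt_0_INR; lia).
  assert (HK0 : 0 < INR K) by (apply lt_0_INR; lia).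
  assert (Hd : 0 < / INR ((2 * m + 1) * K))
    by (rewrite mult_INR; apply Rinv_0_lt_compat, Rmult_lt_0_compat; lra).
  eapply Rle_trans; [apply tbound_tsum; [exact Hi|apply tbound_sample; [lia|exact Hd|exact Hi]|]|].
  - intros x. apply sample_right; [lia|exact Hd|].
    rewrite !mult_INR. change (INR 2) with 2.
    rewrite plus_INR, mult_INR in Hn0. change (INR 2) with 2 in Hn0.
    rewrite (plus_INR (2 * m)), mult_INR. change (INR 2) with 2. field. lra.
  - right. rewrite <- Rmult_assoc, (Rmult_comm (INR (2 * m + 1))), (Rmult_assoc (2 * INR s)).
    f_equal.
    rewrite scal_sum. apply sum_eq. intros j _. unfold kern, chord.
    set (a := Rabs (2 * sin (freq m t i / 2))).
    assert (Ha : 0 < a) by (apply Rabs_pos_lt; lra).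
    rewrite mult_INR, Rinv_mult, !Rpow_mult_distr, !pow_inv, Rinv_mult.
    cbn [pow]. field. repeat split; try apply pow_nonzero; lra.
Qed.

Lemma sample_coarse (s l n K k : nat) : (1 <= n)%nat -> (1 <= K)%nat ->
  sample s l (/ INR (n * K)) (INR (n * k)) = sample s l (/ INR K) (INR k).
Proof.
  intros Hn HK. unfold sample.
  replace (/ INR (n * K) * INR (n * k)) with (/ INR K * INR k); [reflexivity|].
  rewrite !mult_INR. field. split; apply not_0_INR; lia.
Qed.

Lemma sample_filter (s l m K : nat) (t phi : R) : (1 <= K)%nat ->
  INR (2 * m + 1) * tsum (2 * K) t phi (sample s l (/ INR K))
  = sum_f_R0 (fun i => tsum ((2 * m + 1) * (2 * K)) (freq m t i) phi
                         (sample s l (/ INR ((2 * m + 1) * K)))) (2 * m).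
Proof.
  intros HK. unfold tsum.
  rewrite (unity_filter m (2 * K) t phi (fun q => sample s l (/ INR ((2 * m + 1) * K)) (INR q))).
  f_equal. apply sum_eq. intros k _. now rewrite sample_coarse by lia.
Qed.

(* The limit [m -> oo] of this inequality is what the Poisson summation formula
   gives: the chords converge to the frequencies [t + 2 pi j]. *)
Lemma sample_tsum_bound (s l m K : nat) (t phi : R) : (2 <= s)%nat -> (1 <= K)%nat ->
  (forall i, (i <= 2 * m)%nat -> sin (freq m t i / 2) <> 0) ->
  Rabs (tsum (2 * K) t phi (sample s l (/ INR K)))
  <= 2 * INR s * sum_f_R0 (fun j => Binomial.C l j * rising s j * (/ INR K) ^ (s - 1 + j)
       * sum_f_R0 (fun i => / chord m t i ^ S (s - 1 + j)) (2 * m)) l.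
Proof.
  intros Hs HK Hi.
  assert (Hn0 : 0 < INR (2 * m + 1)) by (apply lt_0_INR; lia).
  apply (Rmult_le_reg_l (INR (2 * m + 1))); [exact Hn0|].
  rewrite <- (Rabs_pos_eq (INR (2 * m + 1))) at 1 by lra.
  rewrite <- Rabs_mult, sample_filter by exact HK.
  eapply Rle_trans; [apply Rsum_abs|].
  eapply Rle_trans; [apply sum_Rle; intros i Hi'; apply fine_sample_bound; auto|].
  right. rewrite (sum_eq _ (fun i => sum_f_R0 (fun j => kern s l j (/ INR K) (chord m t i)) l
                           * (INR (2 * m + 1) * (2 * INR s)))) by (intros; ring).
  rewrite <- scal_sum, Rmult_assoc. do 2 f_equal.
  rewrite sum_swap. apply sum_eq. intros j _. rewrite scal_sum. apply sum_eq.
  intros i _. unfold kern. ring.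
Qed.

(** * Sums over chords *)

(** If [PI] were larger, [cos (3143 / 2000)] would be nonnegative, but the Taylor polynomial of
    degree 8 bounds it from above and is negative there. *)
Lemma PI_lt_3143 : PI < 3143 / 1000.
Proof.
  apply Rnot_le_lt. intros H.
  assert (H0 : 0 <= cos (3143 / 2000)) by (apply cos_ge_0; lra).
  destruct (cos_bound (3143 / 2000) 1) as [_ Hc]; [lra|lra|].
  assert (F : forall n, INR (fact (S n)) = (INR n + 1) * INR (fact n))
    by (intros; rewrite fact_simpl, mult_INR, S_INR; reflexivity).
  unfold cos_approx, cos_term in Hc.
  cbn [sum_f_R0 Nat.mul Nat.add] in Hc. rewrite !F in Hc. cbn [INR fact pow] in Hc. lra.
Qed.

Lemma PI_gt_3 : 3 < PI.
Proof. pose proof PI2_3_2. unfold PI2 in *. lra. Qed.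

Lemma sin_ge_cubic (x : R) : 0 <= x <= PI / 2 -> x * (1 - x ^ 2 / 6) <= sin x.
Proof.
  intros H. pose proof PI_RGT_0.
  destruct (sin_bound x 0) as [Hs _]; [lra|lra|].
  unfold sin_approx, sin_term in Hs. simpl in Hs. simpl. lra.
Qed.

(** The constant [10 / 17] is just below [1 - (PI / 2)^2 / 6]. *)
Lemma sin_ge_linear (x : R) : 0 <= x <= PI / 2 -> x * (10 / 17) <= sin x.
Proof.
  intros H. eapply Rle_trans; [|now apply sin_ge_cubic].
  apply Rmult_le_compat_l; [lra|]. pose proof PI_lt_3143. nra.
Qed.

Lemma bernoulli (e : R) (p : nat) : 0 <= e <= 1 -> 1 - INR p * e <= (1 - e) ^ p.
Proof.
  intros He. induction p as [|p IH]; [simpl; lra|].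
  rewrite S_INR. simpl. pose proof (pos_INR p). nra.
Qed.

Definition gap (m : nat) (t : R) (i : nat) : R := Rabs (t + 2 * PI * (INR i - INR m)).

Lemma chord_gap (m : nat) (t : R) (i : nat) : Rabs t <= PI -> (i <= 2 * m)%nat ->
  0 <= gap m t i / (2 * INR (2 * m + 1)) <= PI / 2 /\
  chord m t i = INR (2 * m + 1) * (2 * sin (gap m t i / (2 * INR (2 * m + 1)))).
Proof.
  intros Ht Hi. pose proof PI_RGT_0 as Hpi.
  assert (Hn : 0 < INR (2 * m + 1)) by (apply lt_0_INR; lia).
  assert (H : 0 <= gap m t i / (2 * INR (2 * m + 1)) <= PI / 2).
  { split.
    - apply Rmult_le_pos; [apply Rabs_pos|]. left. apply Rinv_0_lt_compat. lra.
    - apply (Rmult_le_reg_r (2 * INR (2 * m + 1))); [lra|].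
      replace (gap m t i / (2 * INR (2 * m + 1)) * (2 * INR (2 * m + 1)))
        with (gap m t i) by (field; lra).
      rewrite INR_odd. apply le_INR in Hi. rewrite mult_INR in Hi. change (INR 2) with 2 in Hi.
      pose proof (pos_INR i). apply Rabs_le. pose proof (Rle_abs t). pose proof (Rle_abs (- t)) as Ht'. rewrite Rabs_Ropp in Ht'.
      split; nra. }
  split; [exact H|]. unfold chord. f_equal.
  rewrite Rabs_mult, (Rabs_pos_eq 2) by lra. f_equal.
  rewrite <- (Rabs_pos_eq (sin (gap m t i / _))) by (apply sin_ge_0; lra).
  unfold gap, freq. set (w := t + 2 * PI * (INR i - INR m)).
  replace (w / INR (2 * m + 1) / 2) with (w / (2 * INR (2 * m + 1))) by (field; lra).
  destruct (Rcase_abs w) as [Hw|Hw].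
  - rewrite (Rabs_left w Hw).
    replace (- w / (2 * INR (2 * m + 1))) with (- (w / (2 * INR (2 * m + 1)))) by (field; lra).
    now rewrite sin_neg, Rabs_Ropp.
  - now rewrite (Rabs_pos_eq w) by lra.
Qed.

Lemma chord_ge (m : nat) (t : R) (i : nat) : Rabs t <= PI -> (i <= 2 * m)%nat ->
  gap m t i * (10 / 17) <= chord m t i.
Proof.
  intros Ht Hi. destruct (chord_gap m t i Ht Hi) as [Hx ->].
  assert (Hn : 0 < INR (2 * m + 1)) by (apply lt_0_INR; lia).
  apply sin_ge_linear in Hx. set (x := gap m t i / _) in *.
  replace (gap m t i) with (x * (2 * INR (2 * m + 1))) by (unfold x; field; lra). nra.
Qed.

(** The relative error of the chord is at most [e = x^2 / 6] with [x <= 8 / n], and by Bernoulli's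
    inequality the [p]-th power loses at most [p e <= 1 / 2000]. The limit 16 covers the two nearest
    gaps on either side, which stay below [4 PI]. *)
Lemma chord_fine (m p : nat) (t : R) (i : nat) : Rabs t <= PI -> (i <= 2 * m)%nat ->
  (6 <= p)%nat -> (100 * p <= 2 * m + 1)%nat -> 0 < gap m t i <= 16 ->
  gap m t i ^ p <= 1001 / 1000 * chord m t i ^ p.
Proof.
  intros Ht Hi Hp Hm HD. destruct (chord_gap m t i Ht Hi) as [Hx ->].
  set (n := INR (2 * m + 1)) in *.
  assert (Hn : 100 * INR p <= n).
  { apply le_INR in Hm. rewrite mult_INR in Hm.
    replace (INR 100) with 100 in Hm by (simpl; lra). exact Hm. }
  assert (Hp1 : 6 <= INR p) by (apply le_INR in Hp; simpl in Hp; lra).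
  set (D := gap m t i) in *. set (x := D / (2 * n)) in *.
  assert (HDx : D = 2 * n * x) by (unfold x; field; lra).
  set (e := x ^ 2 / 6).
  assert (Hxn : x * n <= 8) by nra.
  assert (He : INR p * e <= 1 / 2000).
  { assert (x * (100 * INR p) <= 8) by nra.
    assert (0 <= x * INR p <= 8 / 100) by nra.
    assert (x <= 8 / 600) by nra. unfold e.
    assert (x * INR p * x <= 8 / 100 * (8 / 600)) by (apply Rmult_le_compat; lra). nra. }
  assert (He0 : 0 <= e) by (unfold e; nra).
  assert (He1 : e <= 1) by nra.
  pose proof (bernoulli e p (conj He0 He1)) as Hb.
  apply Rle_trans with (1001 / 1000 * (D * (1 - e)) ^ p).
  - rewrite Rpow_mult_distr.
    assert (0 < D ^ p) by (apply pow_lt; lra).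
    assert (1 <= 1001 / 1000 * (1 - e) ^ p) by lra. nra.
  - apply Rmult_le_compat_l; [lra|]. apply pow_incr. split; [nra|].
    apply sin_ge_cubic in Hx. fold e in Hx. rewrite HDx. nra.
Qed.

Lemma gap_right (m k : nat) (t : R) : 0 < t <= PI ->
  gap m t (m + k) = t + 2 * PI * INR k.
Proof.
  intros Ht. unfold gap. rewrite plus_INR.
  replace (INR m + INR k - INR m) with (INR k) by ring.
  pose proof (pos_INR k). apply Rabs_pos_eq. nra.
Qed.

Lemma gap_left (m k : nat) (t : R) : (k < m)%nat -> 0 < t <= PI ->
  gap m t (m - 1 - k) = 2 * PI * (INR k + 1) - t.
Proof.
  intros Hk Ht. unfold gap.
  replace (m - 1 - k)%nat with (m - S k)%nat by lia.
  rewrite minus_INR, S_INR by lia. pose proof (pos_INR k). pose proof PI_RGT_0.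
  rewrite Rabs_left1; [ring|]. nra.
Qed.

Lemma sum_center (f : nat -> R) (m : nat) : (1 <= m)%nat ->
  sum_f_R0 f (2 * m)
  = sum_f_R0 (fun k => f (m + k)%nat) m + sum_f_R0 (fun k => f (m - 1 - k)%nat) (m - 1).
Proof.
  intros Hm. rewrite (tech2 f (m - 1) (2 * m)) by lia.
  replace (2 * m - S (m - 1))%nat with m by lia.
  rewrite Rplus_comm. f_equal.
  - apply sum_eq. intros i Hi. f_equal. lia.
  - symmetry. apply (Coquelicot.Rcomplements.sum_f_R0_skip f (m - 1)).
Qed.

(** From [k = 2] on, [1 / (2 k + 1)^2 <= (1 / k - 1 / (k + 1)) / 4] telescopes to at most
    [1 / 8]. *)
Lemma sum_le_odd_squares (h : nat -> R) (A B c : R) (M : nat) :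
  0 <= A -> 0 <= B -> 0 <= c -> h 0%nat <= A -> h 1%nat <= B ->
  (forall k, (2 <= k <= M)%nat -> h k <= c / (2 * INR k + 1) ^ 2) ->
  sum_f_R0 h M <= A + B + c / 8.
Proof.
  intros HA HB Hc H0 H1 H.
  destruct M as [|M]; [simpl; lra|].
  assert (E : sum_f_R0 h (S M) <= A + B + c / 4 * (1 / 2 - / (INR (S M) + 1))).
  { induction M as [|M IH].
    - simpl. lra.
    - rewrite tech5.
      specialize (IH ltac:(intros; apply H; lia)). specialize (H (S (S M)) ltac:(lia)).
      rewrite (S_INR (S M)) in *. pose proof (pos_INR M). rewrite (S_INR M) in *.
      set (x := INR M + 1 + 1) in *.
      assert (Hx : 2 <= x) by (unfold x; lra).
      assert (c / (2 * x + 1) ^ 2 <= c / 4 * (/ x - / (x + 1))).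
      { replace (c / 4 * (/ x - / (x + 1))) with (c * / (4 * x * (x + 1))) by (field; lra).
        apply Rmult_le_compat_l; [exact Hc|]. apply Rinv_le_contravar; nra. }
      unfold x in *. lra. }
  assert (0 < / (INR (S M) + 1)) by (apply Rinv_0_lt_compat; pose proof (pos_INR (S M)); lra).
  nra.
Qed.

Lemma chord_pos (m : nat) (t : R) (i : nat) : Rabs t <= PI -> (i <= 2 * m)%nat ->
  0 < gap m t i -> 0 < chord m t i.
Proof. intros Ht Hi HD. pose proof (chord_ge m t i Ht Hi). lra. Qed.

Lemma chord_term_fine (m p i : nat) (t q : R) : 0 < t <= PI -> (i <= 2 * m)%nat ->
  (6 <= p)%nat -> (100 * p <= 2 * m + 1)%nat -> 0 < q -> q * t <= gap m t i <= 16 ->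
  t ^ p * / chord m t i ^ p <= 1001 / 1000 * (/ q) ^ p.
Proof.
  intros Ht Hi Hp Hm Hq HD.
  assert (Ht' : Rabs t <= PI) by (rewrite Rabs_pos_eq; lra).
  assert (Hqt : 0 < q * t) by nra.
  pose proof (chord_fine m p t i Ht' Hi Hp Hm ltac:(lra)) as Hc.
  pose proof (chord_pos m t i Ht' Hi ltac:(lra)) as Hc0.
  assert (Hpow : (q * t) ^ p <= gap m t i ^ p) by (apply pow_incr; lra).
  assert (H1 : 0 < chord m t i ^ p) by now apply pow_lt.
  assert (H2 : 0 < q ^ p) by now apply pow_lt.
  rewrite Rpow_mult_distr in Hpow. rewrite pow_inv.
  apply (Rmult_le_reg_r (chord m t i ^ p * q ^ p)); [nra|].
  replace (t ^ p * / chord m t i ^ p * (chord m t i ^ p * q ^ p)) with (q ^ p * t ^ p)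
    by (field; lra).
  replace (1001 / 1000 * / q ^ p * (chord m t i ^ p * q ^ p))
    with (1001 / 1000 * chord m t i ^ p) by (field; lra).
  lra.
Qed.

Lemma chord_term_crude (m p i : nat) (t q : R) : 0 < t <= PI -> (i <= 2 * m)%nat ->
  (6 <= p)%nat -> 5 <= q -> q * t <= gap m t i ->
  t ^ p * / chord m t i ^ p <= (34 / 100) ^ 4 * (17 / 10) ^ 2 / q ^ 2.
Proof.
  intros Ht Hi Hp Hq HD.
  assert (Ht' : Rabs t <= PI) by (rewrite Rabs_pos_eq; lra).
  assert (Hqt : 0 < q * t) by nra.
  pose proof (chord_ge m t i Ht' Hi) as Hc.
  assert (Hc0 : 0 < chord m t i) by lra.
  rewrite <- pow_inv, <- Rpow_mult_distr.
  set (y := t * / chord m t i). set (z := 17 / 10 * / q).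
  assert (Hy : 0 <= y <= z).
  { split; [apply Rmult_le_pos; [lra|left; now apply Rinv_0_lt_compat]|].
    unfold y, z. apply (Rmult_le_reg_r (chord m t i * q)); [nra|].
    replace (t * / chord m t i * (chord m t i * q)) with (q * t) by (field; lra).
    replace (17 / 10 * / q * (chord m t i * q)) with (17 / 10 * chord m t i) by (field; lra).
    lra. }
  assert (Hz : z <= 34 / 100).
  { unfold z. apply (Rmult_le_reg_r q); [lra|].
    replace (17 / 10 * / q * q) with (17 / 10) by (field; lra). lra. }
  (* Four factors give the constant, two keep the decay in [q], and the rest are at most 1. *)
  replace p with (4 + 2 + (p - 6))%nat by lia. rewrite !pow_add.
  assert (y ^ (p - 6) <= 1) by (rewrite <- (pow1 (p - 6)); apply pow_incr; lra).
  assert (0 <= y ^ (p - 6)) by (apply pow_le; lra).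
  assert (0 <= y ^ 4 <= (34 / 100) ^ 4) by (split; [apply pow_le|apply pow_incr]; lra).
  assert (0 <= y ^ 2 <= z ^ 2) by (split; [apply pow_le|apply pow_incr]; lra).
  replace ((34 / 100) ^ 4 * (17 / 10) ^ 2 / q ^ 2) with ((34 / 100) ^ 4 * z ^ 2 * 1)
    by (unfold z; field; lra).
  apply Rmult_le_compat; try lra; [apply Rmult_le_pos; lra|].
  apply Rmult_le_compat; lra.
Qed.

Lemma inv3_pow_le (p : nat) : (6 <= p)%nat -> (/ 3) ^ p <= / 729.
Proof.
  intros Hp. replace p with (6 + (p - 6))%nat by lia. rewrite pow_add.
  assert ((/ 3) ^ (p - 6) <= 1) by (rewrite <- (pow1 (p - 6)); apply pow_incr; lra).
  assert (0 <= (/ 3) ^ (p - 6)) by (apply pow_le; lra).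
  replace ((/ 3) ^ 6) with (/ 729) by field. lra.
Qed.

(** Since [t <= PI], the [k]-th gap on either side is at least [(2 k + 1) t]. The terms [k = 0, 1]
    are estimated finely and the others crudely. The left [k = 0] term is kept apart because its gap
    [2 PI - t] is close to [t] when [t] is near [PI]. *)
Lemma chord_sum (m p : nat) (t : R) : 0 < t <= PI -> (6 <= p)%nat ->
  (100 * p <= 2 * m + 1)%nat ->
  t ^ p * sum_f_R0 (fun i => / chord m t i ^ p) (2 * m)
  <= 10135 / 10000 + 1001 / 1000 * (/ ((2 * PI - t) / t)) ^ p.
Proof.
  intros Ht Hp Hm. pose proof PI_lt_3143 as Hpi. pose proof PI_gt_3 as Hpi3.
  set (q0 := (2 * PI - t) / t).
  assert (Hq0 : 0 < q0) by (apply Rdiv_lt_0_compat; lra).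
  assert (Hq0p : 0 <= (/ q0) ^ p) by (apply pow_le; left; now apply Rinv_0_lt_compat).
  pose proof (inv3_pow_le p Hp) as H3.
  rewrite scal_sum, sum_center by lia.
  (* The two brackets are the right and the left half of the sum; each lists [k = 0], [k = 1] and
     the tail from [k = 2]. *)
  apply Rle_trans with ((1001 / 1000 + 1001 / 1000 * / 729 + (34 / 100) ^ 4 * (17 / 10) ^ 2 / 8)
    + (1001 / 1000 * (/ q0) ^ p + 1001 / 1000 * / 729 + (34 / 100) ^ 4 * (17 / 10) ^ 2 / 8));
    [|lra].
  apply Rplus_le_compat; apply sum_le_odd_squares; try lra; rewrite ?(Rmult_comm (/ _)).
  - eapply Rle_trans; [apply (chord_term_fine m p _ t 1); try lia; try lra|].
    + rewrite gap_right by exact Ht. simpl. lra.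
    + rewrite Rinv_1, pow1. lra.
  - eapply Rle_trans; [apply (chord_term_fine m p _ t 3); try lia; try lra|lra].
    rewrite gap_right by exact Ht. simpl. lra.
  - intros k Hk. rewrite Rmult_comm.
    assert (2 <= INR k) by (apply (le_INR 2); lia).
    apply chord_term_crude; try lia; try lra.
    rewrite gap_right by exact Ht. nra.
  - apply chord_term_fine; try lia; try lra.
    rewrite gap_left by (lia || exact Ht). unfold q0. simpl.
    replace ((2 * PI - t) / t * t) with (2 * PI - t) by (field; lra). lra.
  - eapply Rle_trans; [apply (chord_term_fine m p _ t 3); try lia; try lra|lra].
    rewrite gap_left by (lia || exact Ht). simpl. lra.
  - intros k Hk. rewrite Rmult_comm.
    assert (2 <= INR k) by (apply (le_INR 2); lia).
    apply chord_term_crude; try lia; try lra.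
    rewrite gap_left by (lia || exact Ht). nra.
Qed.

(** The nearest left term can be as large as the main one, so the constant doubles. *)
Lemma chord_sum_any (m p : nat) (t : R) : 0 < t <= PI -> (6 <= p)%nat ->
  (100 * p <= 2 * m + 1)%nat ->
  sum_f_R0 (fun i => / chord m t i ^ p) (2 * m) <= 2015 / 1000 * / t ^ p.
Proof.
  intros Ht Hp Hm. pose proof (chord_sum m p t Ht Hp Hm) as H.
  assert (Htp : 0 < t ^ p) by (apply pow_lt; lra).
  assert (H1 : (/ ((2 * PI - t) / t)) ^ p <= 1).
  { rewrite <- (pow1 p). apply pow_incr. rewrite Rinv_div. split.
    - left. apply Rdiv_lt_0_compat; lra.
    - apply (Rmult_le_reg_r (2 * PI - t)); [lra|].
      replace (t / (2 * PI - t) * (2 * PI - t)) with t by (field; lra). lra. }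
  apply (Rmult_le_reg_l (t ^ p)); [exact Htp|].
  replace (t ^ p * (2015 / 1000 * / t ^ p)) with (2015 / 1000) by (field; lra). lra.
Qed.

(** For [t <= 1] the nearest left gap is at least [3 t], so the main term dominates. *)
Lemma chord_sum_small (m p : nat) (t : R) : 0 < t <= 1 -> (6 <= p)%nat ->
  (100 * p <= 2 * m + 1)%nat ->
  sum_f_R0 (fun i => / chord m t i ^ p) (2 * m) <= 1015 / 1000 * / t ^ p.
Proof.
  intros Ht Hp Hm. pose proof PI_gt_3 as Hpi.
  pose proof (chord_sum m p t ltac:(lra) Hp Hm) as H.
  assert (Htp : 0 < t ^ p) by (apply pow_lt; lra).
  assert (H1 : (/ ((2 * PI - t) / t)) ^ p <= / 729).
  { eapply Rle_trans; [apply pow_incr|now apply inv3_pow_le]. rewrite Rinv_div. split.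
    - left. apply Rdiv_lt_0_compat; lra.
    - apply (Rmult_le_reg_r (2 * PI - t)); [lra|].
      replace (t / (2 * PI - t) * (2 * PI - t)) with t by (field; lra). lra. }
  apply (Rmult_le_reg_l (t ^ p)); [exact Htp|].
  replace (t ^ p * (1015 / 1000 * / t ^ p)) with (1015 / 1000) by (field; lra). lra.
Qed.

Lemma chord_neq0_sin (m : nat) (t : R) (i : nat) : 0 < chord m t i -> sin (freq m t i / 2) <> 0.
Proof.
  intros H E. unfold chord in H. rewrite E, Rmult_0_r, Rabs_R0 in H. lra.
Qed.

Lemma freq_sin_neq0 (m : nat) (t : R) (i : nat) : 0 < t <= PI -> (i <= 2 * m)%nat ->
  sin (freq m t i / 2) <> 0.
Proof.
  intros Ht Hi. apply chord_neq0_sin, chord_pos; [rewrite Rabs_pos_eq; lra|exact Hi|].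
  pose proof PI_RGT_0 as Hpi. destruct (Nat.le_gt_cases m i) as [H|H].
  - replace i with (m + (i - m))%nat by lia. rewrite gap_right by exact Ht.
    pose proof (pos_INR (i - m)). nra.
  - replace i with (m - 1 - (m - 1 - i))%nat by lia. rewrite gap_left by (lia || exact Ht).
    pose proof (pos_INR (m - 1 - i)). nra.
Qed.

(** * The normalisation *)

Lemma coef_spl (s N j : nat) : (6 <= s)%nat -> Nat.Even s ->
  coef s N j = spl s (s - 1) ((INR j - INR N) / (INR N + 1)).
Proof.
  intros Hs He. unfold coef, gt. rewrite g_spl by assumption. f_equal.
  pose proof (pos_INR N). field. lra.
Qed.

Lemma coef_ge0 (s N j : nat) : (6 <= s)%nat -> Nat.Even s -> 0 <= coef s N j.
Proof. intros Hs He. rewrite coef_spl by assumption. apply spl_ge0; [lia|exact He]. Qed.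

(** The grid of step [1 / (N + 1)] also contains [-1] and [1], where the spline is zero; dropping
    the first point shifts the index, whence [j + 1]. *)
Lemma coef_tsum (s l N : nat) (t phi : R) : (6 <= s)%nat -> Nat.Even s ->
  tsum (2 * S N) t phi (sample s l (/ INR (S N)))
  = sum_f_R0 (fun j => ((INR j - INR N) / INR (S N)) ^ l * coef s N j
                       * cos ((INR j + 1) * t + phi)) (2 * N).
Proof.
  intros Hs He. pose proof (pos_INR N) as HN.
  assert (HK : INR (S N) <> 0) by now apply not_0_INR.
  replace (2 * S N)%nat with (S (S (2 * N))) by lia.
  unfold tsum. rewrite tech5, decomp_sum by lia. simpl pred.
  assert (E0 : sample s l (/ INR (S N)) (INR 0) = 0).
  { unfold sample. rewrite spl_left; [ring|]. simpl. lra. }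
  assert (E1 : sample s l (/ INR (S N)) (INR (S (S (2 * N)))) = 0).
  { unfold sample. rewrite spl_right; [ring|lia|lia|]. right.
    rewrite !S_INR in *. rewrite mult_INR. change (INR 2) with 2. field. exact HK. }
  rewrite E0, E1, !Rmult_0_l, Rplus_0_l, Rplus_0_r.
  apply sum_eq. intros j _. unfold sample. rewrite coef_spl by assumption.
  rewrite !S_INR in *.
  replace (-1 + / (INR N + 1) * (INR j + 1)) with ((INR j - INR N) / (INR N + 1))
    by (field; exact HK).
  reflexivity.
Qed.

Lemma gnorm_tsum (s N : nat) : (6 <= s)%nat -> Nat.Even s ->
  gnorm s N = tsum (2 * S N) 0 0 (sample s 0 (/ INR (S N))).
Proof.
  intros Hs He. rewrite coef_tsum by assumption. apply sum_eq. intros j _.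
  rewrite Rmult_0_r, Rplus_0_r, cos_0. simpl. ring.
Qed.

(* The integral of [g] over [-1, 1]. *)
Definition mass (s : nat) : R := 4 / (2 ^ s * INR (fact (s - 1))).

Lemma mass_pos (s : nat) : 0 < mass s.
Proof.
  apply Rdiv_lt_0_compat; [lra|].
  apply Rmult_lt_0_compat; [apply pow_lt; lra|apply INR_fact_lt_0].
Qed.

(** At [x = 1] no truncation is active, so the value of [altdiff] in degree [s] applies. The left
    side is [spl s s 1], the value at 1 of an antiderivative of the spline. *)
Lemma altdiff_tpow_top (s : nat) : (1 <= s)%nat -> Nat.Even s ->
  altdiff s (fun y => tpow s (1 - y)) = mass s.
Proof.
  intros Hs He. rewrite (altdiff_ext s _ (fun y => / INR (fact s) * (1 - y) ^ s)).
  - rewrite altdiff_scal, altdiff_shift_pow_top by assumption. unfold mass.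
    replace (fact s) with (s * fact (s - 1))%nat
      by (destruct s; [lia|]; simpl; now rewrite Nat.sub_0_r).
    rewrite mult_INR. field. repeat split; try apply pow_nonzero; try lra.
    + apply INR_fact_neq_0.
    + apply not_0_INR. lia.
  - intros y Hy. rewrite tpow_nonneg_arg by (lia || lra). unfold Rdiv. ring.
Qed.

(** Monotonicity places the Riemann sum between the integrals up to the last node and up to one step
    beyond; at the first node [-1] the truncated power is zero. *)
Lemma tpow_riemann (r : nat) (d y : R) (Q : nat) : (1 <= r)%nat -> 0 < d -> -1 <= y ->
  tpow (S r) (-1 + d * INR Q - y)
  <= d * sum_f_R0 (fun q => tpow r (-1 + d * INR q - y)) Q
  <= tpow (S r) (-1 + d * INR Q + d - y).
Proof.
  intros Hr Hd Hy. induction Q as [|Q IH].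
  - cbn [sum_f_R0]. change (INR 0) with 0. rewrite Rmult_0_r, Rplus_0_r.
    rewrite !(tpow_neg _ (-1 - y)) by lra. pose proof (tpow_ge0 (S r) (-1 + d - y)). lra.
  - rewrite tech5, Rmult_plus_distr_l, S_INR.
    pose proof (tpow_mvt r (-1 + d * INR Q - y) d Hr Hd) as H1.
    pose proof (tpow_mvt r (-1 + d * INR Q + d - y) d Hr Hd) as H2.
    replace (-1 + d * INR Q - y + d) with (-1 + d * INR Q + d - y) in H1 by ring.
    replace (-1 + d * (INR Q + 1) - y) with (-1 + d * INR Q + d - y) by ring.
    replace (-1 + d * (INR Q + 1) + d - y) with (-1 + d * INR Q + d - y + d) by ring.
    lra.
Qed.

Lemma spl_riemann (s Q : nat) (d : R) : (2 <= s)%nat -> Nat.Even s -> 0 < d <= 1 ->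
  d * INR Q = 2 ->
  mass s - 2 * INR s * (d * tpow (s - 1) 3)
  <= d * sum_f_R0 (fun q => spl s (s - 1) (-1 + d * INR q)) Q.
Proof.
  intros Hs He Hd HQ.
  pose (A := fun y => d * sum_f_R0 (fun q => tpow (s - 1) (-1 + d * INR q - y)) Q).
  assert (E : d * sum_f_R0 (fun q => spl s (s - 1) (-1 + d * INR q)) Q = altdiff s A).
  { unfold A. rewrite altdiff_scal. f_equal. unfold spl, altdiff. rewrite sum_swap.
    apply sum_eq. intros k _. rewrite <- minus_sum, scal_sum. apply sum_eq. intros; ring. }
  rewrite E, <- (altdiff_tpow_top s) by (lia || assumption).
  assert (H : Rabs (altdiff s (fun y => A y + -1 * tpow s (1 - y)))
              <= 2 * INR s * (d * tpow (s - 1) 3)).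
  { apply altdiff_bound; [lia|]. intros y Hy.
    pose proof (tpow_riemann (s - 1) d y Q ltac:(lia) ltac:(lra) ltac:(lra)) as [R1 R2].
    replace (S (s - 1)) with s in * by lia. rewrite HQ in R1, R2.
    replace (-1 + 2 - y) with (1 - y) in R1 by ring.
    replace (-1 + 2 + d - y) with (1 - y + d) in R2 by ring.
    pose proof (tpow_mvt (s - 1) (1 - y) d ltac:(lia) ltac:(lra)) as [_ M].
    replace (S (s - 1)) with s in M by lia.
    (* The argument is at most 3 because [y >= -1] and [d <= 1]. *)
    assert (T : tpow (s - 1) (1 - y + d) <= tpow (s - 1) 3) by (apply tpow_incr; lra).
    fold (A y) in R1, R2. rewrite Rabs_pos_eq by lra. nra. }
  rewrite altdiff_plus, altdiff_scal in H.
  pose proof (Rle_abs (- (altdiff s A + -1 * altdiff s (fun y => tpow s (1 - y))))) as H'.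
  rewrite Rabs_Ropp in H'. lra.
Qed.

Lemma sum_inv_squares (M : nat) : sum_f_R0 (fun k => / (INR k + 1) ^ 2) M <= 2.
Proof.
  assert (E : sum_f_R0 (fun k => / (INR k + 1) ^ 2) M <= 2 - / (INR M + 1)).
  { induction M as [|M IH]; [simpl; lra|].
    rewrite tech5, S_INR. pose proof (pos_INR M).
    assert (/ (INR M + 1 + 1) ^ 2 <= / (INR M + 1) - / (INR M + 1 + 1)).
    { replace (/ (INR M + 1) - / (INR M + 1 + 1)) with (/ ((INR M + 1) * (INR M + 1 + 1)))
        by (field; lra).
      apply Rinv_le_contravar; nra. }
    lra. }
  assert (0 < / (INR M + 1)) by (apply Rinv_0_lt_compat; pose proof (pos_INR M); lra). lra.
Qed.

Lemma fine_sample_at_0 (s m K i k : nat) : (2 <= s)%nat -> (1 <= K)%nat -> (i <= 2 * m)%nat ->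
  gap m 0 i = 2 * PI * (INR k + 1) ->
  Rabs (tsum ((2 * m + 1) * (2 * K)) (freq m 0 i) 0 (sample s 0 (/ INR ((2 * m + 1) * K))))
  <= INR (2 * m + 1) * (2 * INR s * ((/ INR K) ^ (s - 1) * (2 / 7) ^ s)) * / (INR k + 1) ^ 2.
Proof.
  intros Hs HK Hi HD. pose proof PI_gt_3 as Hpi. pose proof (pos_INR k) as Hk.
  assert (Ht : Rabs 0 <= PI) by (rewrite Rabs_R0; lra).
  pose proof (chord_ge m 0 i Ht Hi) as Hc. rewrite HD in Hc.
  (* The factor [2 PI * 10 / 17] exceeds [60 / 17], hence [7 / 2]. *)
  assert (Hc1 : 7 / 2 * (INR k + 1) <= chord m 0 i) by nra.
  eapply Rle_trans; [apply fine_sample_bound; [lia|lia|apply chord_neq0_sin; nra]|].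
  rewrite (Rmult_assoc (INR (2 * m + 1))).
  apply Rmult_le_compat_l; [apply pos_INR|].
  rewrite (Rmult_assoc (2 * INR s)).
  apply Rmult_le_compat_l; [pose proof (pos_INR s); lra|].
  cbn [sum_f_R0]. unfold kern, rising, Binomial.C. rewrite Nat.add_0_r.
  replace (S (s - 1)) with s by lia. simpl fact. simpl INR at 1 2 3.
  replace (1 / (1 * 1) * (INR (fact (s - 1)) / INR (fact (s - 1)))) with 1
    by (field; apply INR_fact_neq_0).
  rewrite Rmult_1_l, Rmult_assoc. apply Rmult_le_compat_l.
  - apply pow_le. left. apply Rinv_0_lt_compat, lt_0_INR. lia.
  - apply Rle_trans with (/ (7 / 2 * (INR k + 1)) ^ s).
    + apply Rinv_le_contravar; [apply pow_lt; lra|]. apply pow_incr. lra.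
    + rewrite Rpow_mult_distr, Rinv_mult, <- pow_inv. rewrite Rinv_div.
      apply Rmult_le_compat_l; [apply pow_le; lra|].
      apply Rinv_le_contravar; [apply pow_lt; lra|].
      apply Rle_pow; [lra|lia].
Qed.

(** At [t = 0] the middle frequency is 0, and its sum is a Riemann sum for the integral of [g]; the
    other frequencies are errors, at most [2 c] in total on either side. The term with
    [1 / (2 m + 1)] is the Riemann error, which [gnorm_ge] removes by taking [m] large. *)
Lemma gnorm_ge_fine (s N m : nat) : (6 <= s)%nat -> Nat.Even s -> (1 <= m)%nat ->
  INR (S N) * mass s - 2 * INR s * tpow (s - 1) 3 / INR (2 * m + 1)
  - 8 * INR s * ((/ INR (S N)) ^ (s - 1) * (2 / 7) ^ s)
  <= gnorm s N.
Proof.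
  intros Hs He Hm. rewrite gnorm_tsum by assumption.
  set (K := S N). set (S0 := tsum _ _ _ _). set (n := INR (2 * m + 1)).
  assert (Hn : 3 <= n) by (unfold n; rewrite INR_odd; pose proof (le_INR 1 m Hm); simpl in *; lra).
  assert (HK : 1 <= INR K) by (apply (le_INR 1); unfold K; lia).
  pose proof (sample_filter s 0 m K 0 0 ltac:(unfold K; lia)) as F. fold S0 n in F.
  set (f := fun i => tsum _ _ _ _) in F.
  rewrite sum_center, decomp_sum in F by lia.
  replace (pred m) with (m - 1)%nat in F by lia. rewrite Nat.add_0_r in F.
  set (c := n * (2 * INR s * ((/ INR K) ^ (s - 1) * (2 / 7) ^ s))).
  assert (Hc : 0 <= c).
  { unfold c. pose proof (pos_INR s).
    assert (0 <= (/ INR K) ^ (s - 1)) by (apply pow_le; left; apply Rinv_0_lt_compat; lra).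
    assert (0 <= (2 / 7) ^ s) by (apply pow_le; lra).
    repeat apply Rmult_le_pos; lra. }
  assert (B : forall u : nat -> R, (forall k, (k <= m - 1)%nat -> Rabs (u k) <= c * / (INR k + 1) ^ 2) ->
            - (2 * c) <= sum_f_R0 u (m - 1)).
  { intros u Hu.
    assert (H : Rabs (sum_f_R0 u (m - 1)) <= 2 * c).
    { eapply Rle_trans; [apply Rsum_abs|]. eapply Rle_trans; [apply sum_Rle, Hu|].
      rewrite (sum_eq _ (fun k => / (INR k + 1) ^ 2 * c)) by (intros; ring).
      rewrite <- scal_sum. pose proof (sum_inv_squares (m - 1)). nra. }
    pose proof (Rle_abs (- sum_f_R0 u (m - 1))) as H'. rewrite Rabs_Ropp in H'. lra. }
  assert (B1 : - (2 * c) <= sum_f_R0 (fun k => f (m + S k)%nat) (m - 1)).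
  { apply B. intros k Hk. unfold f, c, n. apply fine_sample_at_0; [lia|unfold K; lia|lia|].
    unfold gap. rewrite plus_INR, S_INR. pose proof (pos_INR k). pose proof PI_RGT_0.
    rewrite Rabs_pos_eq; [ring|]. nra. }
  assert (B2 : - (2 * c) <= sum_f_R0 (fun k => f (m - 1 - k)%nat) (m - 1)).
  { apply B. intros k Hk. unfold f, c, n. apply fine_sample_at_0; [lia|unfold K; lia|lia|].
    unfold gap. replace (m - 1 - k)%nat with (m - S k)%nat by lia.
    rewrite minus_INR, S_INR by lia. pose proof (pos_INR k). pose proof PI_RGT_0.
    rewrite Rabs_left1; [ring|]. nra. }
  assert (Hd0 : n * INR K <> 0) by nra.
  assert (R0 : n * INR K * mass s - 2 * INR s * tpow (s - 1) 3 <= f m).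
  { pose (d := / INR ((2 * m + 1) * K)).
    assert (Ed : d = / (n * INR K)) by (unfold d, n; now rewrite mult_INR).
    assert (Hd : 0 < d <= 1).
    { rewrite Ed. split; [apply Rinv_0_lt_compat; nra|].
      rewrite <- Rinv_1. apply Rinv_le_contravar; nra. }
    pose proof (spl_riemann s ((2 * m + 1) * (2 * K)) d ltac:(lia) He Hd) as R0.
    assert (Ef : f m = sum_f_R0 (fun q => spl s (s - 1) (-1 + d * INR q)) ((2 * m + 1) * (2 * K))).
    { unfold f, tsum. apply sum_eq. intros q _. unfold sample. fold d.
      replace (freq m 0 m) with 0 by (unfold freq, Rdiv; ring).
      rewrite Rmult_0_r, Rplus_0_r, cos_0. simpl pow. ring. }
    rewrite <- Ef in R0.
    apply (Rmult_le_reg_l d); [lra|].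
    apply Rle_trans with (mass s - 2 * INR s * (d * tpow (s - 1) 3)).
    - right. rewrite Ed. field. lra.
    - apply R0. rewrite Ed, mult_INR, mult_INR. fold n. change (INR 2) with 2. field. lra. }
  apply (Rmult_le_reg_l n); [lra|]. rewrite F.
  replace (n * (INR K * mass s - 2 * INR s * tpow (s - 1) 3 / n
                - 8 * INR s * ((/ INR K) ^ (s - 1) * (2 / 7) ^ s)))
    with (n * INR K * mass s - 2 * INR s * tpow (s - 1) 3 - 4 * c)
    by (unfold c; field; lra).
  lra.
Qed.

Lemma fact_le_pow (s : nat) : INR (fact s) <= INR s ^ s.
Proof.
  assert (E : forall k, (k <= s)%nat -> INR (fact k) <= INR s ^ k).
  { induction k as [|k IH]; intros Hk; [simpl; lra|].
    rewrite fact_simpl, mult_INR. cbn [pow].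
    apply Rmult_le_compat; try apply pos_INR; [apply le_INR; lia|apply IH; lia]. }
  now apply E.
Qed.

Lemma gnorm_ge (s N : nat) : (6 <= s)%nat -> Nat.Even s -> (2 * s <= N)%nat ->
  998 / 1000 * (INR (S N) * mass s) <= gnorm s N.
Proof.
  intros Hs He HN.
  set (X := INR (S N) * mass s - 8 * INR s * ((/ INR (S N)) ^ (s - 1) * (2 / 7) ^ s)).
  assert (H1 : X <= gnorm s N).
  { apply Rnot_lt_le. intros Hlt.
    set (T := 2 * INR s * tpow (s - 1) 3).
    destruct (INR_unbounded (T / (X - gnorm s N))) as [m Hm].
    pose proof (gnorm_ge_fine s N (S m) Hs He ltac:(lia)) as H. fold T in H.
    assert (Hn : INR m < INR (2 * S m + 1)) by (apply lt_INR; lia).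
    assert (Hn0 : 0 < INR (2 * S m + 1)) by (apply lt_0_INR; lia).
    assert (T / INR (2 * S m + 1) < X - gnorm s N).
    { apply (Rmult_lt_reg_r (INR (2 * S m + 1))); [exact Hn0|].
      replace (T / INR (2 * S m + 1) * INR (2 * S m + 1)) with T by (field; lra).
      replace T with (T / (X - gnorm s N) * (X - gnorm s N)) by (field; lra). nra. }
    unfold X in *. lra. }
  eapply Rle_trans; [|exact H1]. unfold X.
  assert (HsR : 6 <= INR s) by (apply le_INR in Hs; simpl in Hs; lra).
  assert (HK : 2 * INR s <= INR (S N)).
  { apply Rle_trans with (INR N); [|apply le_INR; lia].
    apply le_INR in HN. now rewrite mult_INR in HN. }
  set (K := INR (S N)) in *.
  assert (Hf := INR_fact_lt_0 (s - 1)).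
  assert (H2 : 0 < 2 ^ s) by (apply pow_lt; lra).
  assert (E : 8 * INR s * ((/ K) ^ (s - 1) * (2 / 7) ^ s)
              = 2 * (INR (fact s) * (4 / (7 * K)) ^ s) * (K * mass s)).
  { unfold mass.
    replace (INR (fact s)) with (INR s * INR (fact (s - 1)))
      by (rewrite <- mult_INR; f_equal; destruct s; [lia|]; simpl; now rewrite Nat.sub_0_r).
    replace (4 / (7 * K)) with (2 / 7 * (/ K * 2)) by (field; lra).
    rewrite !Rpow_mult_distr.
    replace ((/ K) ^ s) with (/ K * (/ K) ^ (s - 1))
      by (change (/ K * (/ K) ^ (s - 1)) with ((/ K) ^ S (s - 1)); f_equal; lia).
    field. lra. }
  rewrite E.
  (* Here [N >= 2 s] enters: the relative error is governed by [s! (4 / (7 K))^s <= (2 / 7)^s],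
     which is below [1 / 1000] for [s >= 6]. *)
  assert (L : INR (fact s) * (4 / (7 * K)) ^ s <= 1 / 1000).
  { apply Rle_trans with (INR s ^ s * (2 / (7 * INR s)) ^ s).
    - apply Rmult_le_compat; [left; apply INR_fact_lt_0| |apply fact_le_pow|].
      + apply pow_le. left. apply Rdiv_lt_0_compat; lra.
      + apply pow_incr. split; [left; apply Rdiv_lt_0_compat; lra|].
        replace (2 / (7 * INR s)) with (4 / (7 * (2 * INR s))) by (field; lra).
        apply Rmult_le_compat_l; [lra|]. apply Rinv_le_contravar; lra.
    - rewrite <- Rpow_mult_distr.
      replace (INR s * (2 / (7 * INR s))) with (2 / 7) by (field; lra).
      replace s with (6 + (s - 6))%nat by lia. rewrite pow_add.
      assert ((2 / 7) ^ (s - 6) <= 1) by (rewrite <- (pow1 (s - 6)); apply pow_incr; lra).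
      assert (0 <= (2 / 7) ^ (s - 6)) by (apply pow_le; lra).
      assert (0 <= (2 / 7) ^ 6 <= 1 / 1000) by lra. nra. }
  assert (0 < K * mass s) by (apply Rmult_lt_0_compat; [lra|apply mass_pos]).
  nra.
Qed.

(** * The estimate *)

Definition trig_moment (s N l : nat) (t phi : R) : R :=
  sum_f_R0 (fun j => coef s N j * (INR j - INR N) ^ l * cos ((INR j - INR N) * t + phi)) (2 * N).

Lemma trig_moment_tsum (s N l : nat) (t phi : R) : (6 <= s)%nat -> Nat.Even s ->
  trig_moment s N l t phi
  = INR (S N) ^ l * tsum (2 * S N) t (phi - INR (S N) * t) (sample s l (/ INR (S N))).
Proof.
  intros Hs He. rewrite coef_tsum by assumption. unfold trig_moment. rewrite scal_sum.
  apply sum_eq. intros j _.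
  replace ((INR j + 1) * t + (phi - INR (S N) * t)) with ((INR j - INR N) * t + phi)
    by (rewrite S_INR; ring).
  unfold Rdiv. rewrite Rpow_mult_distr, pow_inv. field.
  apply pow_nonzero, not_0_INR. lia.
Qed.

(** The factor by which the weight [x^l] enlarges the bound for [l = 0]; it is used at
    [v = 1 / ((N + 1) t)]. *)
Definition poly_bound (s l : nat) (v : R) : R :=
  sum_f_R0 (fun i => Binomial.C l i * rising s i * v ^ i) l.

Lemma trig_moment_bound (s N l : nat) (t phi kappa : R) : (6 <= s)%nat -> Nat.Even s ->
  (l <= 3)%nat -> 0 < t <= PI ->
  (forall m p, (6 <= p)%nat -> (100 * p <= 2 * m + 1)%nat ->
     sum_f_R0 (fun i => / chord m t i ^ p) (2 * m) <= kappa * / t ^ p) ->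
  Rabs (trig_moment s N l t phi)
  <= INR (S N) * INR (S N) ^ l * (2 * INR s * (kappa * poly_bound s l (/ (INR (S N) * t))))
     * / (INR (S N) * t) ^ s.
Proof.
  intros Hs He Hl Ht Hk. rewrite trig_moment_tsum by assumption.
  set (K := INR (S N)).
  assert (HK : 0 < K) by (apply lt_0_INR; lia).
  rewrite Rabs_mult, (Rabs_pos_eq (K ^ l)) by (apply pow_le; lra).
  eapply Rle_trans.
  { apply Rmult_le_compat_l; [apply pow_le; lra|].
    (* This [m] satisfies [100 p <= 2 m + 1] for all exponents [p = s + i <= s + 3]. *)
    apply (sample_tsum_bound s l (50 * (s + 4)) (S N)); [lia|lia|].
    intros i Hi. now apply freq_sin_neq0. }
  fold K. set (A := sum_f_R0 _ l).
  assert (HA : A <= K * (kappa * poly_bound s l (/ (K * t))) * / (K * t) ^ s).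
  { unfold A, poly_bound. rewrite scal_sum, Rmult_assoc, (Rmult_comm (sum_f_R0 _ _)), <- Rmult_assoc, scal_sum.
    apply sum_Rle. intros i Hi.
    apply Rle_trans with (Binomial.C l i * rising s i * (/ K) ^ (s - 1 + i) * (kappa * / t ^ S (s - 1 + i))).
    - apply Rmult_le_compat_l.
      + apply Rmult_le_pos; [|apply pow_le; left; now apply Rinv_0_lt_compat].
        apply Rmult_le_pos; left; [apply binom_pos|apply rising_pos].
      + apply Hk; lia.
    - right. replace (S (s - 1 + i)) with (s + i)%nat by lia.
      replace ((/ K) ^ (s - 1 + i)) with (K * / K ^ (s + i)).
      + rewrite (pow_inv (K * t)), !Rpow_mult_distr, !pow_add. field.
        repeat split; try apply pow_nonzero; lra.
      + rewrite pow_inv. replace (s + i)%nat with (S (s - 1 + i)) by lia. cbn [pow].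
        field. split; [apply pow_nonzero|]; lra. }
  assert (0 <= K ^ l) by (apply pow_le; lra). pose proof (pos_INR s).
  apply Rle_trans with (K ^ l * (2 * INR s * (K * (kappa * poly_bound s l (/ (K * t))) * / (K * t) ^ s))).
  - apply Rmult_le_compat_l; [assumption|]. apply Rmult_le_compat_l; [lra|exact HA].
  - right. ring.
Qed.

Lemma trig_moment_trivial (s N l : nat) (t phi : R) : (6 <= s)%nat -> Nat.Even s ->
  Rabs (trig_moment s N l t phi) <= INR (S N) ^ l * gnorm s N.
Proof.
  intros Hs He. unfold trig_moment, gnorm. eapply Rle_trans; [apply Rsum_abs|].
  rewrite scal_sum. apply sum_Rle. intros j Hj.
  rewrite !Rabs_mult, (Rabs_pos_eq (coef s N j)) by now apply coef_ge0.
  rewrite <- RPow_abs, Rmult_assoc. apply Rmult_le_compat_l; [now apply coef_ge0|].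
  rewrite <- (Rmult_1_r (INR (S N) ^ l)).
  apply Rmult_le_compat; [apply pow_le, Rabs_pos|apply Rabs_pos| |].
  - apply pow_incr. split; [apply Rabs_pos|]. apply Rabs_le.
    apply le_INR in Hj. rewrite mult_INR in Hj. change (INR 2) with 2 in Hj.
    pose proof (pos_INR j). rewrite S_INR. lra.
  - apply Rabs_le, COS_bound.
Qed.

(** * An elementary lower bound for the factorial, and the constants *)

Lemma exp_INR_mul (n : nat) (x : R) : exp (INR n * x) = exp x ^ n.
Proof.
  induction n as [|n IH]; [simpl; rewrite Rmult_0_l; apply exp_0|].
  rewrite S_INR, Rmult_plus_distr_r, Rmult_1_l, exp_plus, IH. simpl. ring.
Qed.

Lemma exp_1_le : exp 1 <= 11 / 4.
Proof.
  (* The inequality [1 + x <= e^x] at [x = -1 / 64], raised to the power 64, bounds [1 / e] from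
     below by more than [4 / 11]. *)
  assert (H : (63 / 64) ^ 64 <= exp (- (1))).
  { replace (- (1)) with (INR 64 * (-1 / 64)) by (simpl; field).
    rewrite exp_INR_mul. apply pow_incr. split; [lra|].
    pose proof (exp_ineq1_le (-1 / 64)). lra. }
  assert (H2 : 4 / 11 <= (63 / 64) ^ 64) by lra.
  rewrite exp_Ropp in H. pose proof (exp_pos 1) as Hp.
  apply (Rmult_le_reg_r (4 / 11)); [lra|].
  apply Rle_trans with (exp 1 * / exp 1).
  - apply Rmult_le_compat_l; lra.
  - rewrite Rinv_r; lra.
Qed.

(** The induction step uses [(1 + 1 / k)^k <= e <= 11 / 4]. *)
Lemma fact_lower (s : nat) : (4 / 11 * INR s) ^ s <= INR (fact s).
Proof.
  destruct s as [|s]; [simpl; lra|].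
  induction s as [|s IH]; [simpl; lra|].
  set (k := S s) in *. assert (Hk : 0 < INR k) by (apply lt_0_INR; unfold k; lia).
  rewrite fact_simpl, mult_INR, S_INR. cbn [pow].
  replace (4 / 11 * (INR k + 1)) with (4 / 11 * INR k * (1 + / INR k)) at 2 by (field; lra).
  rewrite Rpow_mult_distr.
  assert (H : (1 + / INR k) ^ k <= 11 / 4).
  { eapply Rle_trans; [|apply exp_1_le].
    replace 1 with (INR k * / INR k) at 2 by (field; lra). rewrite exp_INR_mul.
    apply pow_incr. assert (0 < / INR k) by now apply Rinv_0_lt_compat.
    split; [lra|]. apply exp_ineq1_le. }
  assert (0 <= (4 / 11 * INR k) ^ k) by (apply pow_le; lra).
  assert (0 <= (1 + / INR k) ^ k).
  { apply pow_le. assert (0 < / INR k) by now apply Rinv_0_lt_compat. lra. }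
  assert (P : (4 / 11 * INR k) ^ k * (1 + / INR k) ^ k <= INR (fact k) * (11 / 4))
    by (apply Rmult_le_compat; assumption).
  nra.
Qed.

Definition lin_const (l s : nat) : R :=
  match l with
  | 0 => INR s
  | 1 => 2 * INR s
  | 2 => 4 * INR s + 1
  | _ => 9 * INR s - 2
  end.

Lemma cst_mass (l s : nat) : cst l s = 408 / 100 * lin_const l s / mass s.
Proof.
  unfold cst, mass. fold (lin_const l s). field.
  split; [apply INR_fact_neq_0|apply pow_nonzero; lra].
Qed.

Lemma poly_bound_0 (s : nat) (v : R) : poly_bound s 0 v = 1.
Proof.
  unfold poly_bound, rising, Binomial.C. cbn [sum_f_R0]. rewrite Nat.add_0_r.
  simpl. field. apply INR_fact_neq_0.
Qed.

Lemma rising_S (s i : nat) : (1 <= s)%nat -> rising s (S i) = (INR s + INR i) * rising s i.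
Proof.
  intros Hs. unfold rising. rewrite Nat.add_succ_r, fact_simpl, mult_INR.
  replace (S (s - 1 + i)) with (s + i)%nat by lia. rewrite plus_INR. unfold Rdiv. ring.
Qed.

Lemma rising_0 (s : nat) : rising s 0 = 1.
Proof. unfold rising. rewrite Nat.add_0_r. field. apply INR_fact_neq_0. Qed.

Lemma poly_bound_1 (s : nat) (v : R) : (1 <= s)%nat -> poly_bound s 1 v = 1 + INR s * v.
Proof.
  intros Hs. unfold poly_bound, Binomial.C. cbn [sum_f_R0].
  rewrite !rising_S, rising_0 by lia. simpl. field.
Qed.

Lemma poly_bound_2 (s : nat) (v : R) : (1 <= s)%nat ->
  poly_bound s 2 v = 1 + 2 * INR s * v + INR s * (INR s + 1) * v ^ 2.
Proof.
  intros Hs. unfold poly_bound, Binomial.C. cbn [sum_f_R0].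
  rewrite !rising_S, rising_0 by lia. simpl. field.
Qed.

Lemma poly_bound_3 (s : nat) (v : R) : (1 <= s)%nat ->
  poly_bound s 3 v = 1 + 3 * INR s * v + 3 * (INR s * (INR s + 1)) * v ^ 2
                     + INR s * (INR s + 1) * (INR s + 2) * v ^ 3.
Proof.
  intros Hs. unfold poly_bound, Binomial.C. cbn [sum_f_R0].
  rewrite !rising_S, rising_0 by lia. simpl. field.
Qed.

(** For [s >= 6], [(s + 1) / s <= 7 / 6] and [(s + 1) (s + 2) / s^2 <= 14 / 9]. *)
Lemma poly_bound_le (s l : nat) (v y : R) : (6 <= s)%nat -> (l <= 3)%nat ->
  0 <= v -> INR s * v <= y ->
  poly_bound s l v <= match l with
    | 0 => 1 | 1 => 1 + y | 2 => 1 + 2 * y + 7 / 6 * y ^ 2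
    | _ => 1 + 3 * y + 7 / 2 * y ^ 2 + 14 / 9 * y ^ 3 end.
Proof.
  intros Hs Hl Hv Hy.
  assert (HS : 6 <= INR s) by (apply le_INR in Hs; simpl in Hs; lra).
  set (S := INR s) in *. set (x := S * v) in *.
  assert (Hx : 0 <= x) by (unfold x; nra).
  assert (Hx2 : x ^ 2 <= y ^ 2) by (apply pow_incr; lra).
  assert (Hx3 : x ^ 3 <= y ^ 3) by (apply pow_incr; lra).
  assert (Hx20 : 0 <= x ^ 2) by (apply pow_le; lra).
  assert (Hx30 : 0 <= x ^ 3) by (apply pow_le; lra).
  assert (Q1 : S * (S + 1) * v ^ 2 <= 7 / 6 * x ^ 2) by (unfold x in *; nra).
  assert (Q2 : S * (S + 1) * (S + 2) * v ^ 3 <= 14 / 9 * x ^ 3).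
  { replace (14 / 9 * x ^ 3) with (14 / 9 * S ^ 3 * v ^ 3) by (unfold x; ring).
    apply Rmult_le_compat_r; [apply pow_le; lra|]. nra. }
  destruct l as [|[|[|[|l]]]]; [..|lia].
  - rewrite poly_bound_0. lra.
  - rewrite poly_bound_1 by lia. fold S x. lra.
  - rewrite poly_bound_2 by lia. fold S. replace (2 * S * v) with (2 * x) by (unfold x; ring). lra.
  - rewrite poly_bound_3 by lia. fold S. replace (3 * S * v) with (3 * x) by (unfold x; ring). lra.
Qed.

(** The budget 2.035 allows for the loss in [gnorm_ge]: [2 * 2.035 = 4.07 <= 4.08 * 0.998], where
    [4.08 = 4 * 1.02] comes from [cst_mass]. *)
Lemma trig_moment_main (s N l : nat) (t phi kappa : R) : (6 <= s)%nat -> Nat.Even s ->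
  (2 * s <= N)%nat -> (l <= 3)%nat -> 0 < t <= PI -> 0 <= kappa ->
  (forall m p, (6 <= p)%nat -> (100 * p <= 2 * m + 1)%nat ->
     sum_f_R0 (fun i => / chord m t i ^ p) (2 * m) <= kappa * / t ^ p) ->
  INR s * (kappa * poly_bound s l (/ (INR (S N) * t))) <= 2035 / 1000 * lin_const l s ->
  Rabs (trig_moment s N l t phi)
  <= gnorm s N * (INR (S N) ^ l * cst l s / (INR (S N) * t) ^ s).
Proof.
  intros Hs He HN Hl Ht Hk0 Hk HP.
  eapply Rle_trans; [now apply (trig_moment_bound s N l t phi kappa)|].
  pose proof (gnorm_ge s N Hs He HN) as HG.
  rewrite cst_mass. set (K := INR (S N)) in *.
  assert (HK : 0 < K) by (apply lt_0_INR; lia).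
  assert (Hu : 0 < / (K * t) ^ s) by (apply Rinv_0_lt_compat, pow_lt; nra).
  assert (Hl0 : 0 <= K ^ l) by (apply pow_le; lra).
  pose proof (mass_pos s) as HI.
  set (P := poly_bound _ _ _) in *. set (c := lin_const l s) in *.
  assert (Hc : 0 <= c).
  { unfold c, lin_const. apply le_INR in Hs. simpl INR in Hs.
    destruct l as [|[|[|l]]]; lra. }
  apply Rle_trans with (K * K ^ l * (4070 / 1000 * c) * / (K * t) ^ s).
  - apply Rmult_le_compat_r; [lra|]. apply Rmult_le_compat_l; [nra|]. lra.
  - replace (K * K ^ l * (4070 / 1000 * c) * / (K * t) ^ s)
      with (K ^ l * c * / (K * t) ^ s * (4070 / 1000 * K)) by ring.
    replace (gnorm s N * (K ^ l * (408 / 100 * c / mass s) / (K * t) ^ s))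
      with (K ^ l * c * / (K * t) ^ s * (408 / 100 * gnorm s N / mass s))
      by (field; split; [lra|apply pow_nonzero; nra]).
    apply Rmult_le_compat_l.
    + apply Rmult_le_pos; [|lra]. now apply Rmult_le_pos.
    + apply (Rmult_le_reg_r (mass s)); [lra|].
      replace (408 / 100 * gnorm s N / mass s * mass s) with (408 / 100 * gnorm s N)
        by (field; lra). nra.
Qed.

Lemma lin_const_ge (l s : nat) : (6 <= s)%nat -> INR s <= lin_const l s.
Proof.
  intros Hs. apply le_INR in Hs. simpl INR in Hs.
  unfold lin_const. destruct l as [|[|[|l]]]; lra.
Qed.

(** With [K = N + 1], [(K t)^s <= 2^s (4 s / 11)^s <= 2^s s!], so the trivial bound suffices. *)
Lemma trig_moment_small (s N l : nat) (t phi : R) : (6 <= s)%nat -> Nat.Even s ->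
  0 < t -> INR (S N) * t <= 8 / 11 * INR s ->
  Rabs (trig_moment s N l t phi)
  <= gnorm s N * (INR (S N) ^ l * cst l s / (INR (S N) * t) ^ s).
Proof.
  intros Hs He Ht Hu.
  eapply Rle_trans; [now apply trig_moment_trivial|].
  set (K := INR (S N)) in *. assert (HK : 0 < K) by (apply lt_0_INR; lia).
  rewrite Rmult_comm. apply Rmult_le_compat_l.
  { apply cond_pos_sum. intros; now apply coef_ge0. }
  assert (Hp : 0 < (K * t) ^ s) by (apply pow_lt; nra).
  apply (Rmult_le_reg_r ((K * t) ^ s)); [exact Hp|].
  replace (K ^ l * cst l s / (K * t) ^ s * (K * t) ^ s) with (K ^ l * cst l s)
    by (field; lra).
  apply Rmult_le_compat_l; [apply pow_le; lra|].
  apply Rle_trans with ((2 * (4 / 11 * INR s)) ^ s).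
  { apply pow_incr. split; [nra|lra]. }
  rewrite Rpow_mult_distr. unfold cst. fold (lin_const l s).
  assert (H2 : 0 < 2 ^ s) by (apply pow_lt; lra).
  pose proof (fact_lower s) as Hf. pose proof (lin_const_ge l s Hs) as Hc.
  replace (INR (fact s)) with (INR (fact (s - 1)) * INR s) in Hf
    by (rewrite <- mult_INR; f_equal; destruct s; [lia|]; simpl; rewrite Nat.sub_0_r; lia).
  pose proof (INR_fact_lt_0 (s - 1)) as Hf0. pose proof (pos_INR s).
  assert (INR (fact (s - 1)) * INR s <= INR (fact (s - 1)) * lin_const l s)
    by (apply Rmult_le_compat_l; lra).
  replace (102 / 100 * INR (fact (s - 1)) * 2 ^ s * lin_const l s)
    with (2 ^ s * (102 / 100 * (INR (fact (s - 1)) * lin_const l s))) by ring.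
  apply Rmult_le_compat_l; nra.
Qed.

(** For [t <= 1] the chord constant is 1.015; the trivial bound serves [u <= 8 s / 11], and
    elsewhere [s / u <= 11 / 8]. For [t > 1] the constant is 2.015, but [N >= 2 s] gives
    [s / u <= 1 / 2]. The case [l = 0], [t > 1] leaves the least room, 2.015 against 2.035. *)
Lemma trig_moment_le (s N l : nat) (t phi : R) : (6 <= s)%nat -> Nat.Even s ->
  (2 * s <= N)%nat -> (l <= 3)%nat -> 0 < t <= PI ->
  Rabs (trig_moment s N l t phi)
  <= gnorm s N * (INR (S N) ^ l * cst l s / (INR (S N) * t) ^ s).
Proof.
  intros Hs He HN Hl Ht.
  assert (HS : 6 <= INR s) by (apply le_INR in Hs; simpl in Hs; lra).
  assert (HK : 2 * INR s <= INR (S N)).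
  { apply Rle_trans with (INR N); [|apply le_INR; lia].
    apply le_INR in HN. now rewrite mult_INR in HN. }
  set (u := INR (S N) * t) in *.
  assert (Hv : forall c, 0 < c -> c * INR s <= u -> 0 <= / u /\ INR s * / u <= / c).
  { intros c Hc H. assert (Hu : 0 < u) by (unfold u; nra). split.
    - left. now apply Rinv_0_lt_compat.
    - apply (Rmult_le_reg_r (c * u)); [nra|].
      replace (INR s * / u * (c * u)) with (c * INR s) by (field; lra).
      replace (/ c * (c * u)) with u by (field; lra). exact H. }
  destruct (Rle_dec t 1) as [H1|H1].
  - destruct (Rle_dec u (8 / 11 * INR s)) as [H2|H2].
    + now apply trig_moment_small.
    + apply (trig_moment_main s N l t phi (1015 / 1000)); try assumption; [lra| |].
      * intros; apply chord_sum_small; lra || lia.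
      * destruct (Hv (8 / 11) ltac:(lra) ltac:(lra)) as [V1 V2].
        pose proof (poly_bound_le s l (/ u) _ Hs Hl V1 V2) as HP. fold u.
        destruct l as [|[|[|[|l]]]]; [..|lia]; unfold lin_const; nra.
  - apply (trig_moment_main s N l t phi (2015 / 1000)); try assumption; [lra| |].
    + intros; apply chord_sum_any; lra || lia.
    + destruct (Hv 2 ltac:(lra) ltac:(unfold u; nra)) as [V1 V2].
      pose proof (poly_bound_le s l (/ u) _ Hs Hl V1 V2) as HP. fold u.
      destruct l as [|[|[|[|l]]]]; [..|lia]; unfold lin_const; nra.
Qed.

(** * Derivatives of the trigonometric polynomial and the final bound *)

Lemma nth_deriv_family (F : nat -> R -> R) (n : nat) (f h : R -> R) :
  (forall k t, derivable_pt_lim (F k) t (F (S k) t)) -> (forall t, f t = F 0%nat t) ->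
  nth_deriv n f h -> forall t, h t = F n t.
Proof.
  intros HF Hf Hn. induction Hn as [f|n f h h' Hn IH Hh]; [exact Hf|].
  intros t. specialize (IH Hf).
  apply (uniqueness_limite (F n) t); [|apply HF].
  apply (derivable_pt_lim_ext h); [exact IH|apply Hh].
Qed.

(** Each derivative multiplies a coefficient by its integer frequency and adds [PI / 2] to the
    phase. The real part has [phi = 0], the imaginary part [phi = - PI / 2]. *)
Definition sigma_deriv (s N : nat) (phi : R) (l : nat) (t : R) : R :=
  / gnorm s N * trig_moment s N l t (INR l * (PI / 2) + phi).

Lemma sigma_deriv_step (s N : nat) (phi : R) (l : nat) (t : R) :
  derivable_pt_lim (sigma_deriv s N phi l) t (sigma_deriv s N phi (S l) t).
Proof.
  unfold sigma_deriv.
  apply (derivable_pt_lim_scal (fun t => trig_moment s N l t (INR l * (PI / 2) + phi))).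
  apply (derivable_pt_lim_sum
    (fun j t => coef s N j * (INR j - INR N) ^ l * cos ((INR j - INR N) * t + (INR l * (PI / 2) + phi)))
    (fun j t => coef s N j * (INR j - INR N) ^ S l * cos ((INR j - INR N) * t + (INR (S l) * (PI / 2) + phi)))).
  intros j _. set (k := INR j - INR N). set (p := INR l * (PI / 2) + phi).
  replace (coef s N j * k ^ S l * cos (k * t + (INR (S l) * (PI / 2) + phi)))
    with (coef s N j * k ^ l * (- sin (k * t + p) * (k * 1 + 0))).
  - apply (derivable_pt_lim_scal (fun t => cos (k * t + p))).
    apply (derivable_pt_lim_comp (fun t => k * t + p) cos).
    + apply (derivable_pt_lim_plus (fun t => k * t) (fct_cte p)).
      * apply (derivable_pt_lim_scal id). apply derivable_pt_lim_id.
      * apply derivable_pt_lim_const.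
    + apply derivable_pt_lim_cos.
  - replace (k * t + (INR (S l) * (PI / 2) + phi)) with (PI / 2 + (k * t + p))
      by (unfold p; rewrite S_INR; ring).
    rewrite cos_plus, cos_PI2, sin_PI2. simpl. ring.
Qed.

(** The modulus is the projection onto the direction of [(X, Y)] itself, whose angle is
    [acos (X / r)] up to the sign of [Y]. *)
Lemma norm_le_of_projections (X Y B : R) :
  (forall psi, X * cos psi + Y * sin psi <= B) -> sqrt (X ^ 2 + Y ^ 2) <= B.
Proof.
  intros H. set (r := sqrt (X ^ 2 + Y ^ 2)).
  assert (Hr : r * r = X ^ 2 + Y ^ 2) by (apply sqrt_sqrt; nra).
  destruct (sqrt_pos (X ^ 2 + Y ^ 2)) as [H0|H0]; fold r in H0.
  - assert (Hc : -1 <= X / r <= 1).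
    { split; apply (Rmult_le_reg_r r); try lra;
      replace (X / r * r) with X by (field; lra); nra. }
    assert (Hs : sin (acos (X / r)) = Rabs (Y / r)).
    { rewrite sin_acos by exact Hc. rewrite <- sqrt_Rsqr_abs. f_equal. unfold Rsqr.
      replace (1 - X / r * (X / r)) with ((r * r - X ^ 2) / (r * r)) by (field; lra).
      rewrite Hr at 1. field. lra. }
    assert (E : X * (X / r) + Y * (Y / r) = r).
    { replace (X * (X / r) + Y * (Y / r)) with ((X ^ 2 + Y ^ 2) / r) by (field; lra).
      rewrite <- Hr. field. lra. }
    rewrite <- E. destruct (Rle_dec 0 (Y / r)) as [Hy|Hy].
    + specialize (H (acos (X / r))).
      rewrite cos_acos, Hs, Rabs_pos_eq in H by assumption. exact H.
    + specialize (H (- acos (X / r))).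
      rewrite cos_neg, sin_neg, cos_acos, Hs, Rabs_left in H by lra. lra.
  - rewrite <- H0 in *. assert (X = 0) by nra. assert (Y = 0) by nra. subst.
    specialize (H 0). lra.
Qed.

Theorem theoremA3 :
  forall (s N : nat), Nat.Even s -> (6 <= s)%nat -> (2 * s <= N)%nat ->
  forall (l : nat), (l <= 3)%nat ->
  forall (dre dim : R -> R),
    nth_deriv l (sigma_re s N) dre -> nth_deriv l (sigma_im s N) dim ->
  forall t : R, -PI <= t <= PI -> t <> 0 ->
    sqrt (dre t ^ 2 + dim t ^ 2) <=
      cst l s / ((INR N + 1) ^ (s - l) * Rabs t ^ s).
Proof.
  intros s N He Hs HN l Hl dre dim Hre Him t Ht Ht0.
  assert (Ere : dre t = sigma_deriv s N 0 l t).
  { apply (nth_deriv_family _ l (sigma_re s N)); [apply sigma_deriv_step| |exact Hre].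
    intros x. unfold sigma_re, sigma_deriv, trig_moment. f_equal. apply sum_eq. intros j _.
    simpl. rewrite Rmult_0_l, !Rplus_0_r. ring. }
  assert (Eim : dim t = sigma_deriv s N (- (PI / 2)) l t).
  { apply (nth_deriv_family _ l (sigma_im s N)); [apply sigma_deriv_step| |exact Him].
    intros x. unfold sigma_im, sigma_deriv, trig_moment. f_equal. apply sum_eq. intros j _.
    rewrite <- cos_shift, <- cos_neg. simpl. rewrite Rmult_1_r. do 2 f_equal. ring. }
  rewrite Ere, Eim.
  assert (HK : 0 < INR (S N)) by (apply lt_0_INR; lia).
  assert (HG : 0 < gnorm s N).
  { eapply Rlt_le_trans; [|now apply gnorm_ge].
    pose proof (mass_pos s). assert (0 < INR (S N) * mass s) by nra. lra. }
  assert (Hta : 0 < Rabs t <= PI) by (split; [now apply Rabs_pos_lt|apply Rabs_le; lra]).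
  assert (Hb : forall phi, Rabs (trig_moment s N l t phi)
     <= gnorm s N * (INR (S N) ^ l * cst l s / (INR (S N) * Rabs t) ^ s)).
  (* A negative [t] is replaced by [|t|] with the opposite phase, as the cosine is even. *)
  { intros phi. destruct (Rcase_abs t) as [Hn|Hp].
    - replace (trig_moment s N l t phi) with (trig_moment s N l (Rabs t) (- phi)).
      + now apply trig_moment_le.
      + rewrite Rabs_left by exact Hn. apply sum_eq. intros j _. f_equal.
        rewrite <- cos_neg. f_equal. ring.
    - replace t with (Rabs t) at 1 by (apply Rabs_pos_eq; lra). now apply trig_moment_le. }
  apply norm_le_of_projections. intros psi.
  (* The projection at angle [psi] is again a single moment, with the phase moved by [- psi], so
     combining real and imaginary parts costs no factor [sqrt 2]. *)
  replace (sigma_deriv s N 0 l t * cos psi + sigma_deriv s N (- (PI / 2)) l t * sin psi)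
    with (/ gnorm s N * trig_moment s N l t (INR l * (PI / 2) - psi)).
  - apply (Rmult_le_reg_l (gnorm s N)); [exact HG|].
    rewrite <- Rmult_assoc, Rinv_r, Rmult_1_l by lra.
    eapply Rle_trans; [apply Rle_abs|]. eapply Rle_trans; [apply Hb|].
    right. f_equal. rewrite <- S_INR, Rpow_mult_distr.
    replace (INR (S N) ^ s) with (INR (S N) ^ l * INR (S N) ^ (s - l))
      by (rewrite <- pow_add; f_equal; lia).
    field. repeat split; apply pow_nonzero; lra.
  - unfold sigma_deriv. rewrite !Rmult_assoc, <- Rmult_plus_distr_l. f_equal.
    unfold trig_moment. rewrite (Rmult_comm _ (cos psi)), (Rmult_comm _ (sin psi)), !scal_sum, <- sum_plus.
    apply sum_eq. intros j _. set (k := (INR j - INR N) * t).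
    replace (k + (INR l * (PI / 2) - psi)) with (k + INR l * (PI / 2) - psi) by ring.
    replace (k + (INR l * (PI / 2) + 0)) with (k + INR l * (PI / 2)) by ring.
    replace (k + (INR l * (PI / 2) + - (PI / 2))) with (- (PI / 2 - (k + INR l * (PI / 2)))) by ring.
    rewrite cos_neg, cos_shift, cos_minus. ring.
Qed.
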